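(* In the setting described in the context, let $(x(t),(y_{ij}(t))_{i\neq j})$, $t\ge 0$, be the solution, from given initial values, of the distributed dynamics $$\dot x_i=\varsigma(t)\Big(\mathcal P_{\Omega_i}\big[x_i-\gamma(t)\big(\nabla_{x_i}f_i(y_i)+\varepsilon(t)\nabla_{x_i}P(y_i)+\delta(t)x_i\big)\big]-x_i\Big),\quad i\in\mathcal V,$$ $$\dot y_{ij}=-w(t)\sum_{k=1}^N a_{ik}(y_{ij}-y_{kj}),\quad i\in\mathcal V,\ j\in\mathcal V\setminus\{i\},$$ where $y_{ii}=x_i$ and $y_i=[y_{i1},\dots,y_{iN}]^T$. Put $$u_1(t)=-\gamma^2(t)\big(Nb_1'^2+Nb_2^2\varepsilon^2(t)+\delta^2(t)+1\big)+2\gamma(t)\delta(t),\qquad u_2(t)=(\gamma^2(t)+1)(b_3^2+b_2^2\varepsilon^2(t)),$$ $$r_2(t)=\frac{|\dot\delta(t)|+|\dot\varepsilon(t)|}{\delta(t)},\qquad E_{u_1\varsigma}(t)=\int_0^t\frac{u_1(s)\varsigma(s)}{4}\,ds,$$ $$\theta(t)=w(t)\lambda_{\min}-\frac{u_2(t)\varsigma(t)}{2}-\frac{\varsigma(t)(2-u_1(t))(N-1)^2}{u_1(t)}-\frac{u_1(t)u_2(t)\varsigma(t)}{4(2-u_1(t))}.$$ Suppose that: (i) $0<u_1(t)<1$ for all $t\ge0$; $\lim_{t\to\infty}\frac{r_2(t)}{u_1(t)\varsigma(t)}=0$; $\lim_{t\to\infty}\int_0^t u_1(s)\varsigma(s)\,ds=\infty$;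 and $\int_0^t r_2(s)e^{E_{u_1\varsigma}(s)}ds$ is either bounded in $t$ or tends to $\infty$ as $t\to\infty$; (ii) $\dfrac{\int_0^t r_2(s)e^{E_{u_1\varsigma}(s)}ds}{e^{E_{u_1\varsigma}(t)}}\le c_0'$ for all $t\ge 0$; (iii) $\lim_{t\to\infty}\delta(t)=0$, $\lim_{t\to\infty}\delta^2(t)\varepsilon(t)=\infty$, $\lim_{t\to\infty}\varepsilon(t)=\infty$; (iv) $\theta(t)\ge\frac14u_1(t)\varsigma(t)$ for all $t\ge0$. Then $\lim_{t\to\infty}x(t)=x^*$, where $x^*$ is the least-norm variational equilibrium of the game.
   Context: Game. There are $N$ players $\mathcal V=\{1,\dots,N\}$; player $i$ chooses $x_i\in\Omega_i\subset\mathbb R$ and solves $\min_{x_i\in\Omega_i}f_i(x_i,x_{-i})$ subject to the shared constraint $g(x)=Ax-b\le0$ (componentwise), where $x=[x_1,\dots,x_N]^T$, $A\in\mathbb R^{n\times N}$, $b\in\mathbb R^n$, $f_i:\mathbb R^N\to\mathbb R$. Standing assumptions. (1) Each $f_i$ is twice continuously differentiable on $\mathbb R^N$ and convex in $x_i\in\mathbb R$ for every $x_{-i}\in\mathbb R^{N-1}$. (2) $F(x)=[\nabla_{x_1}f_1(x),\dots,\nabla_{x_N}f_N(x)]^T$ is monotone on $\mathbb R^N$: $(F(x)-F(y))^T(x-y)\ge0$. (3) Each $\Omega_i$ is nonempty, convex and compact, and with $\Omega=\Omega_1\times\cdots\times\Omega_N$ the set $Q=\{x\in\Omega: g(x)\le0\}$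 satisfies Slater's condition (there is $x_{\rm int}\in\Omega$ with $Ax_{\rm int}-b<0$ componentwise). (4) The communication graph $\mathcal G$ on $\mathcal V$, with adjacency matrix $[a_{ij}]$ ($a_{ij}=a_{ji}$, $a_{ij}>0$ iff $(j,i)$ is an edge, otherwise $a_{ij}=0$; $a_{ii}=0$), is undirected and connected. VI. For a convex set $K$ and a map $\Phi$, VI$(K,\Phi)$ asks for $x\in K$ with $(y-x)^T\Phi(x)\ge0$ for all $y\in K$. A variational equilibrium of the game is a solution of VI$(Q,F)$; $x^*$ is the unique solution of VI$(Q,F)$ of least Euclidean norm. $\mathcal P_K$ is Euclidean projection onto $K$; $\|\cdot\|$ is the Euclidean norm. Penalty. $P(x)=\sum_{k=1}^nP_k(x)$, $P_k(x)=0$ if $g_k(x)\le0$ and $P_k(x)=(g_k(x))^2$ otherwise, where $g_k$ is the $k$-th component of $g$. Parameters. $\delta,\varepsilon,\varsigma,\gamma,w:[0,\infty)\to(0,\infty)$ are smooth with finite initial values. $x_t^*$ denotes the unique solution of VI$(\Omega,\Phi_{\delta\varepsilon})$ at time $t$, where $\Phi_{\delta\varepsilon}(x)=F(x)+\delta(t)x+\varepsilon(t)\nabla_xP(x)$. Constants. $c_x,c_p>0$ are such that $\|x\|\le c_x$ and $\|\nabla_xP(x)\|\le c_p$ for all $x\in\Omega$; $c_{px}=\max\{c_x,c_p\}$. $c_0'>0$ is a constant independent of $b_1'$ and $b_3$, and $c'>0$ satisfies $c_{px}c_0'\le c'$. Let $\hat Y_i=[y_{ji}-x_i]_{j\in\mathcal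 V\setminus\{i\}}\in\mathbb R^{N-1}$ and $z=[(x-x_t^* )^T,\hat Y_1^T,\dots,\hat Y_N^T]^T$. The local Lipschitz constants $b_1',b_3>0$ (dependent on the initial values) are such that, for every $i$: $|\nabla_{x_i}f_i(x)-\nabla_{x_i}f_i(x_t^* )|\le b_1'\|x-x_t^*\|$ for all $t\ge0$ and all $x$ with $\|x\|\le\|z(0)\|+c'+c_x$; and $|\nabla_{x_i}f_i(x)-\nabla_{x_i}f_i(y)|\le b_3\|x-y\|$ for all $x$ with $\|x\|\le\|z(0)\|+c'+c_x$ and all $y\in\mathbb R^N$ with $\|y\|\le2(\|z(0)\|+c')+c_x$. $b_2>0$ is a global Lipschitz constant of $\nabla_{x_i}P$ on $\mathbb R^N$ for every $i$. $\lambda_{\min}$ is the smallest of all eigenvalues of the matrices $L_i+B_i$, $i\in\mathcal V$, where $L_i$ is the Laplacian matrix of the subgraph of $\mathcal G$ obtained by deleting vertex $i$, and $B_i=\mathrm{diag}\{a_{1i},\dots,a_{(i-1)i},a_{(i+1)i},\dots,a_{Ni}\}$ (these matrices are symmetric positive definite). *)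

(* Defs.v *)
From HB Require Import structures.
From mathcomp Require Import all_boot all_order all_algebra.
From mathcomp Require Import all_classical all_reals all_analysis.

Set Implicit Arguments.
Unset Strict Implicit.
Unset Printing Implicit Defensive.

Import Order.TTheory GRing.Theory Num.Theory.
Import numFieldNormedType.Exports.

Local Open Scope classical_set_scope.
Local Open Scope ring_scope.

(* Points of R^N are row vectors.  The library norm `|x| of a matrix is the
   sup norm (it generates the usual topology), so the Euclidean norm is
   introduced separately. *)

Definition inner (R : realType) (m : nat) (x y : 'rV[R]_m) : R :=
  (x *m y^T) 0 0.

Definition enorm (R : realType) (m : nat) (x : 'rV[R]_m) : R :=
  Num.sqrt (inner x x).

Definition partial (R : realType) (N : nat) (i : 'I_N) (h : 'rV[R]_N -> R)
    (x : 'rV[R]_N) : R :=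
  'D_(delta_mx 0 i) h x.

Definition grad (R : realType) (N : nat) (h : 'rV[R]_N -> R)
    (x : 'rV[R]_N) : 'rV[R]_N :=
  \row_i partial i h x.

Fixpoint contDiff (R : realType) (N : nat) (k : nat) (h : 'rV[R]_N -> R)
    : Prop :=
  continuous h /\
  match k with
  | 0%N => True
  | k'.+1 => forall i : 'I_N,
      (forall x, derivable h x (delta_mx 0 i)) /\ contDiff k' (partial i h)
  end.

Definition set_coord (R : realType) (N : nat) (x : 'rV[R]_N) (i : 'I_N)
    (s : R) : 'rV[R]_N :=
  \row_j (if j == i then s else x 0 j).

(* Derivative of a function on the half-line [0, +oo[: two-sided at t > 0 and
   from the right at t = 0.  The values of f on the negative reals play no
   role, and [derive0y f t] is only meaningful for 0 <= t. *)
Definition diffquot0y (R : realType) (f : R -> R) (t : R) : set_system R :=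
  (f s - f t) / (s - t) @[s --> within [set s | 0 <= s] t^'].

Definition derivable0y (R : realType) (f : R -> R) (t : R) : Prop :=
  cvg (diffquot0y f t).

Definition derive0y (R : realType) (f : R -> R) (t : R) : R :=
  lim (diffquot0y f t).

(* C^oo on [0, +oo[, with one-sided derivatives of every order at 0. *)
Definition smooth0y (R : realType) (f : R -> R) : Prop :=
  forall (n : nat) (t : R), 0 <= t -> derivable0y (iter n (@derive0y R) f) t.

Definition smooth_positive (R : realType) (f : R -> R) : Prop :=
  smooth0y f /\ forall t, 0 <= t -> 0 < f t.

(* [derive0y f] with the existence requirement, as in an equation f' = v. *)
Definition is_derive0y (R : realType) (f : R -> R) (t v : R) : Prop :=
  derivable0y f t /\ derive0y f t = v.

(* Euclidean projection onto K (nonempty, closed and convex in use). *)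
Definition proj_onto (R : realType) (K : set R) (v : R) : R :=
  xget 0 [set p | K p /\ forall q, K q -> `|v - p| <= `|v - q|].

Definition VI (R : realType) (N : nat) (K : set 'rV[R]_N)
    (Phi : 'rV[R]_N -> 'rV[R]_N) : set 'rV[R]_N :=
  [set x | K x /\ forall y, K y -> 0 <= inner (y - x) (Phi x)].

Definition pseudo_gradient (R : realType) (N : nat)
    (f : 'I_N -> 'rV[R]_N -> R) (x : 'rV[R]_N) : 'rV[R]_N :=
  \row_i partial i (f i) x.

Definition monotone_map (R : realType) (N : nat)
    (F : 'rV[R]_N -> 'rV[R]_N) : Prop :=
  forall x y, 0 <= inner (F x - F y) (x - y).

Definition action_set (R : realType) (N : nat) (Om : 'I_N -> set R)
    : set 'rV[R]_N :=
  [set x | forall i, Om i (x 0 i)].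

Definition constraint (R : realType) (N n : nat) (A : 'M[R]_(n, N))
    (b : 'cV[R]_n) (x : 'rV[R]_N) : 'cV[R]_n :=
  A *m x^T - b.

Definition feasible_set (R : realType) (N n : nat) (Om : 'I_N -> set R)
    (A : 'M[R]_(n, N)) (b : 'cV[R]_n) : set 'rV[R]_N :=
  [set x | action_set Om x /\ forall k, constraint A b x k 0 <= 0].

Definition slater (R : realType) (N n : nat) (Om : 'I_N -> set R)
    (A : 'M[R]_(n, N)) (b : 'cV[R]_n) : Prop :=
  exists2 x, action_set Om x & forall k, constraint A b x k 0 < 0.

Definition variational_equilibrium (R : realType) (N n : nat)
    (f : 'I_N -> 'rV[R]_N -> R) (Om : 'I_N -> set R)
    (A : 'M[R]_(n, N)) (b : 'cV[R]_n) : set 'rV[R]_N :=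
  VI (feasible_set Om A b) (pseudo_gradient f).

Definition least_norm_in (R : realType) (N : nat) (S : set 'rV[R]_N)
    (x : 'rV[R]_N) : Prop :=
  S x /\ forall y, S y -> enorm x <= enorm y.

Definition penalty (R : realType) (N n : nat) (A : 'M[R]_(n, N))
    (b : 'cV[R]_n) (x : 'rV[R]_N) : R :=
  \sum_(k < n) (if constraint A b x k 0 <= 0 then 0
                else constraint A b x k 0 ^+ 2).

(* The regularised and penalised map, at fixed parameter values d and e. *)
Definition Phi_de (R : realType) (N n : nat) (f : 'I_N -> 'rV[R]_N -> R)
    (A : 'M[R]_(n, N)) (b : 'cV[R]_n) (d e : R) (x : 'rV[R]_N) : 'rV[R]_N :=
  pseudo_gradient f x + d *: x + e *: grad (penalty A b) x.

Definition undirected_connected (N : nat) (E : rel 'I_N) : Prop :=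
  symmetric E /\ forall i j, connect E i j.

(* E j i says that (j, i) is an edge; the weight a i j sits on that edge. *)
Definition adjacency_of (R : realType) (N : nat) (E : rel 'I_N)
    (a : 'M[R]_N) : Prop :=
  [/\ forall i j, a i j = a j i,
      forall i j, (0 < a i j) = E j i,
      forall i j, ~~ E j i -> a i j = 0
    & forall i, a i i = 0].

Definition laplacian (R : realType) (m : nat) (a : 'M[R]_m) : 'M[R]_m :=
  diag_mx (\row_i \sum_j a i j) - a.

(* Weighted Laplacian of the subgraph obtained by deleting vertex i. *)
Definition deleted_laplacian (R : realType) (N : nat) (a : 'M[R]_N)
    (i : 'I_N) : 'M[R]_N.-1 :=
  laplacian (row' i (col' i a)).

Definition leader_mx (R : realType) (N : nat) (a : 'M[R]_N) (i : 'I_N)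
    : 'M[R]_N.-1 :=
  diag_mx (\row_j a (lift i j) i).

(* The smallest of all eigenvalues of all the matrices L_i + B_i, i ranging
   over the vertices; its existence forces N >= 2. *)
Definition smallest_eigenvalue (R : realType) (N : nat) (a : 'M[R]_N)
    (l : R) : Prop :=
  (exists i, eigenvalue (deleted_laplacian a i + leader_mx a i) l) /\
  forall i mu, eigenvalue (deleted_laplacian a i + leader_mx a i) mu ->
    l <= mu.

(* The estimates are stored as a matrix y with y j i = y_{ji}; [Yhat x y i]
   lists y_{ji} - x_i for j <> i. *)
Definition Yhat (R : realType) (N : nat) (x : 'rV[R]_N) (y : 'M[R]_N)
    (i : 'I_N) : 'rV[R]_N.-1 :=
  \row_j (y (lift i j) i - x 0 i).

Definition zvec (R : realType) (N : nat) (x : 'rV[R]_N) (y : 'M[R]_N)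
    (xs : 'rV[R]_N) : 'rV[R]_(N + \sum_(i < N) N.-1) :=
  row_mx (x - xs) (\mxrow_(i < N) Yhat x y i).

Definition is_trajectory (R : realType) (N n : nat)
    (f : 'I_N -> 'rV[R]_N -> R) (Om : 'I_N -> set R)
    (A : 'M[R]_(n, N)) (b : 'cV[R]_n) (a : 'M[R]_N)
    (delta eps vsigma gam w : R -> R)
    (x : R -> 'rV[R]_N) (y : R -> 'M[R]_N) : Prop :=
  forall t, 0 <= t ->
  [/\ forall i, y t i i = x t 0 i,
      forall i, is_derive0y (fun s => x s 0 i) t
        (vsigma t *
         (proj_onto (Om i)
            (x t 0 i - gam t *
               (partial i (f i) (row i (y t))
                + eps t * partial i (penalty A b) (row i (y t))
                + delta t * x t 0 i))
          - x t 0 i))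
    & forall i j, j != i -> is_derive0y (fun s => y s i j) t
        (- w t * \sum_k a i k * (y t i j - y t k j))].

Definition u1 (R : realType) (N : nat) (b1 b2 : R) (delta eps gam : R -> R)
    (t : R) : R :=
  - gam t ^+ 2 * (N%:R * b1 ^+ 2 + N%:R * b2 ^+ 2 * eps t ^+ 2
                  + delta t ^+ 2 + 1)
  + 2 * gam t * delta t.

Definition u2 (R : realType) (b2 b3 : R) (eps gam : R -> R) (t : R) : R :=
  (gam t ^+ 2 + 1) * (b3 ^+ 2 + b2 ^+ 2 * eps t ^+ 2).

Definition r2 (R : realType) (delta eps : R -> R) (t : R) : R :=
  (`|derive0y delta t| + `|derive0y eps t|) / delta t.

Definition int0 (R : realType) (h : R -> R) (t : R) : R :=
  \int[lebesgue_measure]_(s in `[0, t]) h s.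

Definition E_int (R : realType) (u vsigma : R -> R) (t : R) : R :=
  int0 (fun s => u s * vsigma s / 4) t.

Definition theta (R : realType) (N : nat) (lmin : R) (u v vsigma w : R -> R)
    (t : R) : R :=
  w t * lmin - v t * vsigma t / 2
  - vsigma t * (2 - u t) * (N%:R - 1) ^+ 2 / u t
  - u t * v t * vsigma t / (4 * (2 - u t)).

(* Main.v *)
Require Import Defs.
From HB Require Import structures.
From mathcomp Require Import all_boot all_order all_algebra.
From mathcomp Require Import all_classical all_reals all_analysis.
From mathcomp Require Import ring lra.
Set Implicit Arguments.
Unset Strict Implicit.
Unset Printing Implicit Defensive.
Import Order.TTheory GRing.Theory Num.Theory.
Import numFieldNormedType.Exports.
Local Open Scope classical_set_scope.
Local Open Scope ring_scope.

(** The actions are compared with the solution [xt t] of the regularised and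
    penalised variational inequality at time [t], which itself moves towards
    [xstar].  Two convergences give the theorem.

    The regularised solutions converge ([regularized_solutions_cvg]).  Testing
    their inequality with feasible points bounds [eps * penalty] at [xt t]
    ([penalized_solution_estimates]), so that the constraint violations are of
    order [eps ^ (-1/2)].  Slater's condition corrects such a point to a feasible
    one at a proportional distance, and comparison with the inequality of
    [xstar] yields [inner (xt t) (xt t - xstar) <= C / sqrt (delta^2 * eps)].
    Every cluster point therefore solves the constrained inequality with a norm
    at most that of [xstar], hence equals [xstar].

    The Lyapunov function [lyap], the squared distance of the actions to [xt]
    plus the squared errors of all estimates, tends to 0.  Four ingredients
    enter.
    - The Lipschitz constants of the costs are local, but a maximum principle
      ([family_barrier], [trajectory_bounds]) confines the trajectory for all
      times to the balls on which they are valid: actions relax towards their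
      compact sets, and estimates follow a consensus led by the actions.
    - For large [t] the penalty dominates every other Lipschitz constant.  The
      variational characterisation of the projection, which keeps the negative
      square of the projected step, then provides the decay rate
      [u1 * vsigma / 2] ([lyap_dissipation]), where the coercivity of the pinned
      Laplacians ([consensus_coercive], from the minimum of the Rayleigh
      quotient) and the condition on [theta] compensate the estimation errors.
    - The target [xt] is known to be locally Lipschitz, with a constant governed by
      [r2] ([VI_Phi_de_lipschitz]).  Derivatives are replaced by upper right
      slopes ([rslope_le], [lyap_slope]).
    - As [r2] is negligible with respect to [u1 * vsigma], whose integral
      diverges, the function vanishes at infinity ([lyapunov_vanishing]). *)

(** * The Euclidean inner product and norm *)

Lemma innerE (R : realType) m (u v : 'rV[R]_m) :
  inner u v = \sum_i u 0 i * v 0 i.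
Proof. by rewrite /inner mxE; apply: eq_bigr => i _; rewrite mxE. Qed.

Lemma innerC (R : realType) m (u v : 'rV[R]_m) : inner u v = inner v u.
Proof. by rewrite !innerE; apply: eq_bigr => i _; rewrite mulrC. Qed.

Lemma innerDl (R : realType) m (u v w : 'rV[R]_m) :
  inner (u + v) w = inner u w + inner v w.
Proof. by rewrite /inner mulmxDl mxE. Qed.

Lemma innerNl (R : realType) m (u v : 'rV[R]_m) : inner (- u) v = - inner u v.
Proof. by rewrite /inner mulNmx mxE. Qed.

Lemma innerBl (R : realType) m (u v w : 'rV[R]_m) :
  inner (u - v) w = inner u w - inner v w.
Proof. by rewrite innerDl innerNl. Qed.

Lemma innerZl (R : realType) m (a : R) (u v : 'rV[R]_m) :
  inner (a *: u) v = a * inner u v.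
Proof. by rewrite /inner -scalemxAl mxE. Qed.

Lemma innerDr (R : realType) m (u v w : 'rV[R]_m) :
  inner w (u + v) = inner w u + inner w v.
Proof. by rewrite !(innerC w) innerDl. Qed.

Lemma innerNr (R : realType) m (u v : 'rV[R]_m) : inner u (- v) = - inner u v.
Proof. by rewrite !(innerC u) innerNl. Qed.

Lemma innerBr (R : realType) m (u v w : 'rV[R]_m) :
  inner w (u - v) = inner w u - inner w v.
Proof. by rewrite innerDr innerNr. Qed.

Lemma innerZr (R : realType) m (a : R) (u v : 'rV[R]_m) :
  inner u (a *: v) = a * inner u v.
Proof. by rewrite !(innerC u) innerZl. Qed.

Lemma inner0l (R : realType) m (u : 'rV[R]_m) : inner 0 u = 0.
Proof. by rewrite -(subrr u) innerBl subrr. Qed.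

Lemma inner_ge0 (R : realType) m (u : 'rV[R]_m) : 0 <= inner u u.
Proof. by rewrite innerE; apply: sumr_ge0 => i _; rewrite -expr2 sqr_ge0. Qed.

Lemma enorm_ge0 (R : realType) m (u : 'rV[R]_m) : 0 <= enorm u.
Proof. exact: sqrtr_ge0. Qed.

Lemma enorm_sqr (R : realType) m (u : 'rV[R]_m) : enorm u ^+ 2 = inner u u.
Proof. by rewrite sqr_sqrtr// inner_ge0. Qed.

Lemma enorm_sum (R : realType) m (u : 'rV[R]_m) :
  enorm u ^+ 2 = \sum_i u 0 i ^+ 2.
Proof. by rewrite enorm_sqr innerE; apply: eq_bigr => i _; rewrite expr2. Qed.

Lemma inner_self_eq0 (R : realType) m (u : 'rV[R]_m) : inner u u <= 0 -> u = 0.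
Proof.
move=> u0; apply/rowP => i; rewrite mxE; apply/eqP.
have : \sum_j u 0 j ^+ 2 == 0.
  by rewrite -enorm_sum enorm_sqr eq_le u0 inner_ge0.
rewrite psumr_eq0 => [/allP/(_ i)|j _]; last exact: sqr_ge0.
by rewrite mem_index_enum sqrf_eq0 => /(_ isT).
Qed.

(** Cauchy-Schwarz, from [inner u u >= 0] at [|v| u - |u| v]. *)
Lemma inner_le_enorm (R : realType) m (u v : 'rV[R]_m) :
  inner u v <= enorm u * enorm v.
Proof.
have [v0|v0] := eqVneq (enorm v) 0.
  have -> : v = 0 by apply: inner_self_eq0; rewrite -enorm_sqr v0 expr0n.
  by rewrite innerC inner0l mulr_ge0// enorm_ge0.
have [u0|u0] := eqVneq (enorm u) 0.
  have -> : u = 0 by apply: inner_self_eq0; rewrite -enorm_sqr u0 expr0n.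
  by rewrite inner0l mulr_ge0// enorm_ge0.
have up : 0 < enorm u by rewrite lt_def u0 enorm_ge0.
have vp : 0 < enorm v by rewrite lt_def v0 enorm_ge0.
have := inner_ge0 (enorm v *: u - enorm u *: v).
rewrite innerBl !innerBr !innerZl !innerZr -!enorm_sqr (innerC v u).
have uvp := mulr_gt0 up vp.
move=> H; rewrite -(ler_pM2l uvp).
by nra.
Qed.

Lemma enorm_triangle (R : realType) m (u v : 'rV[R]_m) :
  enorm (u + v) <= enorm u + enorm v.
Proof.
rewrite -(@ler_pXn2r _ 2)// ?nnegrE ?addr_ge0 ?enorm_ge0//.
rewrite enorm_sqr innerDl !innerDr -!enorm_sqr (innerC v u) sqrrD.
by have := inner_le_enorm u v; lra.
Qed.

Lemma enormN (R : realType) m (u : 'rV[R]_m) : enorm (- u) = enorm u.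
Proof. by rewrite /enorm innerNl innerNr opprK. Qed.

Lemma enormB (R : realType) m (u v : 'rV[R]_m) :
  enorm (u - v) <= enorm u + enorm v.
Proof. by rewrite -(enormN v); exact: enorm_triangle. Qed.

Lemma enorm_le (R : realType) m (u : 'rV[R]_m) (r : R) :
  0 <= r -> \sum_i u 0 i ^+ 2 <= r ^+ 2 -> enorm u <= r.
Proof.
by move=> r0 h; rewrite -(@ler_pXn2r _ 2)// ?nnegrE ?enorm_ge0// enorm_sum.
Qed.

Lemma coord_le_enorm (R : realType) m (u : 'rV[R]_m) i : `|u 0 i| <= enorm u.
Proof.
rewrite -(@ler_pXn2r _ 2)// ?nnegrE ?enorm_ge0//.
rewrite enorm_sum real_normK ?num_real// (bigD1 i)//= lerDl.
by apply: sumr_ge0 => j _; rewrite sqr_ge0.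
Qed.

(** The supremum norm of the library is dominated by the Euclidean one, so
    Euclidean estimates yield convergence in the library topology. *)
Lemma norm_le_enorm (R : realType) m (u : 'rV[R]_m) : `|u| <= enorm u.
Proof.
rewrite [leLHS]mx_normrE.
apply: bigmax_le => [|[i j] _ /=]; first exact: enorm_ge0.
by rewrite ord1; exact: coord_le_enorm.
Qed.

(** * One-sided calculus on the half-line, and a maximum principle *)

Lemma cvg_sumr (R : realType) (T : Type) (F : set_system T) (FF : Filter F)
    (I : finType) (phi : I -> T -> R) (l : I -> R) :
  (forall i, phi i s @[s --> F] --> l i) ->
  \sum_i phi i s @[s --> F] --> \sum_i l i.
Proof.
move=> cphi; apply: cvg_big => [|i _]; last exact: cphi.
exact: pseudometric_normed_Zmodule.add_continuous.
Qed.

Definition cont0y (R : realType) (phi : R -> R) : Prop :=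
  forall t : R, 0 <= t ->
    phi s @[s --> within [set s : R | 0 <= s] (nbhs t)] --> phi t.

Definition rderiv (R : realType) (phi : R -> R) (t v : R) : Prop :=
  (phi s - phi t) / (s - t) @[s --> t^'+] --> v.

(** The upper right Dini derivative of [phi] at [t] is at most [v]. *)
Definition rslope_le (R : realType) (phi : R -> R) (t v : R) : Prop :=
  forall e, 0 < e -> \forall s \near t^'+, phi s - phi t <= (v + e) * (s - t).

Lemma at_right_within0y (R : realType) (t : R) (P : set R) :
  0 <= t -> nbhs t (fun s => s != t -> 0 <= s -> P s) -> t^'+ P.
Proof.
move=> t0 H; suff : nbhs t (fun s => t < s -> P s) by [].
by apply: filterS H => s + ts; apply; rewrite ?gt_eqF//; lra.
Qed.

Lemma is_derive0y_rderiv (R : realType) (phi : R -> R) (t v : R) :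
  0 <= t -> is_derive0y phi t v -> rderiv phi t v.
Proof.
move=> t0 [dphi <-]; apply: cvg_trans dphi; apply: cvg_app => P.
exact: at_right_within0y.
Qed.

Lemma derivable0y_rderiv (R : realType) (phi : R -> R) (t : R) :
  0 <= t -> derivable0y phi t -> rderiv phi t (derive0y phi t).
Proof. by move=> t0 dphi; exact: is_derive0y_rderiv. Qed.

Lemma derivable0y_cont (R : realType) (phi : R -> R) :
  (forall t, 0 <= t -> derivable0y phi t) -> cont0y phi.
Proof.
move=> dphi t t0; have := dphi t t0; set l := derive0y phi t => dl.
have H : (phi s - phi t) / (s - t) @[s --> within [set s : R | 0 <= s] t^'] --> l.
  exact: dl.
have F : Filter (within [set s : R | 0 <= s] t^') by exact: within_filter.
have H1 : (phi s - phi t) / (s - t) * (s - t) + phi t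
    @[s --> within [set s : R | 0 <= s] t^'] --> l * (t - t) + phi t.
  apply: cvgD; last exact: cvg_cst.
  apply: cvgM => //; apply: cvgB; last exact: cvg_cst.
  move=> P HP; suff : nbhs t (fun s => s != t -> 0 <= s -> P s) by [].
  by apply: filterS HP => s.
rewrite subrr mulr0 add0r in H1.
apply/cvgrPdist_lt => e e0.
have [d /= d0 Hd] := (cvgrPdist_lt _ _).1 H1 e e0.
exists d => //= s ts s0.
have [->|st] := eqVneq s t; first by rewrite subrr normr0.
have := Hd s ts st s0; rewrite mulfVK ?subr_eq0//.
by rewrite subrK.
Qed.

Lemma cont0y_right (R : realType) (phi : R -> R) (t : R) :
  0 <= t -> cont0y phi -> phi s @[s --> t^'+] --> phi t.
Proof.
move=> t0 /(_ t t0) cphi; apply: cvg_trans cphi; apply: cvg_app => P H.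
apply: at_right_within0y => //.
have : nbhs t (fun s => 0 <= s -> P s) by [].
by apply: filterS => s Hs _.
Qed.

Lemma cont0y_left (R : realType) (phi : R -> R) (t : R) :
  0 < t -> cont0y phi -> phi s @[s --> t^'-] --> phi t.
Proof.
move=> t0 /(_ t (ltW t0)) cphi; apply: cvg_trans cphi; apply: cvg_app => P H.
have {}H : nbhs t (fun s => 0 <= s -> P s) by [].
have : \forall s \near t^'-, 0 <= s -> P s by exact: cvg_within.
have : \forall s \near t^'-, 0 < s by exact: nbhs_left_gt.
by apply: filterS2 => s s0; apply; rewrite ltW.
Qed.

Lemma cont0y_cst (R : realType) (v : R) : cont0y (fun=> v).
Proof. by move=> t _; exact: cvg_cst. Qed.

Lemma cont0yD (R : realType) (phi psi : R -> R) :
  cont0y phi -> cont0y psi -> cont0y (fun s => phi s + psi s).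
Proof. by move=> cphi cpsi t t0; apply: cvgD; [exact: cphi|exact: cpsi]. Qed.

Lemma cont0yN (R : realType) (phi : R -> R) :
  cont0y phi -> cont0y (fun s => - phi s).
Proof. by move=> cphi t t0; apply: cvgN; exact: cphi. Qed.

Lemma cont0yB (R : realType) (phi psi : R -> R) :
  cont0y phi -> cont0y psi -> cont0y (fun s => phi s - psi s).
Proof. by move=> cphi cpsi; apply: cont0yD => //; exact: cont0yN. Qed.

Lemma cont0yM (R : realType) (phi psi : R -> R) :
  cont0y phi -> cont0y psi -> cont0y (fun s => phi s * psi s).
Proof. by move=> cphi cpsi t t0; apply: cvgM; [exact: cphi|exact: cpsi]. Qed.

Lemma cont0y_sqr (R : realType) (phi : R -> R) :
  cont0y phi -> cont0y (fun s => phi s ^+ 2).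
Proof. by move=> cphi; exact: cont0yM. Qed.

Lemma cont0y_sum (R : realType) (I : finType) (phi : I -> R -> R) :
  (forall i, cont0y (phi i)) -> cont0y (fun s => \sum_i phi i s).
Proof.
move=> cphi t t0.
by apply: cvg_sumr => i; exact: cphi.
Qed.

Lemma rderiv_right (R : realType) (phi : R -> R) (t v : R) :
  rderiv phi t v -> phi s @[s --> t^'+] --> phi t.
Proof.
move=> dphi.
have H : (phi s - phi t) / (s - t) * (s - t) + phi t
    @[s --> t^'+] --> v * (t - t) + phi t.
  apply: cvgD; last exact: cvg_cst.
  apply: cvgM => //; apply: cvgB; last exact: cvg_cst.
  exact: cvg_within.
rewrite subrr mulr0 add0r in H; apply: cvg_trans H.
apply: near_eq_cvg; near=> s.
rewrite mulfVK ?subrK// subr_eq0 gt_eqF//.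
Unshelve. all: by end_near. Qed.

Lemma rderiv_cst (R : realType) (c t : R) : rderiv (fun=> c) t 0.
Proof.
rewrite /rderiv (_ : (fun s => _) = fun=> 0); first exact: cvg_cst.
by apply/funext => s; rewrite subrr mul0r.
Qed.

Lemma rderivD (R : realType) (phi psi : R -> R) (t v w : R) :
  rderiv phi t v -> rderiv psi t w -> rderiv (fun s => phi s + psi s) t (v + w).
Proof.
move=> dphi dpsi; apply: cvg_trans (cvgD dphi dpsi).
by apply: near_eq_cvg; apply: nearW => s /=; rewrite -mulrDl opprD addrACA.
Qed.

Lemma rderivN (R : realType) (phi : R -> R) (t v : R) :
  rderiv phi t v -> rderiv (fun s => - phi s) t (- v).
Proof.
move=> dphi; apply: cvg_trans (cvgN dphi).
by apply: near_eq_cvg; apply: nearW => s /=; rewrite -mulNr opprB opprK addrC.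
Qed.

Lemma rderivB (R : realType) (phi psi : R -> R) (t v w : R) :
  rderiv phi t v -> rderiv psi t w -> rderiv (fun s => phi s - psi s) t (v - w).
Proof. by move=> dphi dpsi; apply: rderivD => //; exact: rderivN. Qed.

Lemma rderivZ (R : realType) (k : R) (phi : R -> R) (t v : R) :
  rderiv phi t v -> rderiv (fun s => k * phi s) t (k * v).
Proof.
move=> dphi; apply: cvg_trans (cvgM (@cvg_cst _ k _ t^'+ _) dphi).
by apply: near_eq_cvg; apply: nearW => s /=; rewrite mulrA -mulrBr.
Qed.

Lemma rderiv_sqr (R : realType) (phi : R -> R) (t v : R) :
  rderiv phi t v -> rderiv (fun s => phi s ^+ 2) t (2 * phi t * v).
Proof.
move=> dphi.
rewrite mulr_natl mulr2n.
apply: cvg_trans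
  (cvgM (cvgD (rderiv_right dphi) (@cvg_cst _ (phi t) _ t^'+ _)) dphi).
apply: near_eq_cvg; apply: nearW => s /=.
by rewrite mulrA subr_sqr [(phi s - _) * _]mulrC.
Qed.

Lemma rderiv_sum (R : realType) (I : finType) (phi : I -> R -> R) (t : R)
    (v : I -> R) :
  (forall i, rderiv (phi i) t (v i)) ->
  rderiv (fun s => \sum_i phi i s) t (\sum_i v i).
Proof.
move=> dphi.
have : \sum_i ((phi i s - phi i t) / (s - t)) @[s --> t^'+] --> \sum_i v i.
  by apply: cvg_sumr => i; exact: dphi.
move=> H; apply: cvg_trans H.
by apply: near_eq_cvg; apply: nearW => s /=; rewrite -mulr_suml sumrB.
Qed.

Lemma rderiv_dist (R : realType) (phi : R -> R) (t v : R) :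
  rderiv phi t v -> rderiv (fun s => `|phi s - phi t|) t `|v|.
Proof.
move=> dphi; apply: cvg_trans (cvg_norm dphi).
apply: near_eq_cvg; near=> s => /=.
have ts : t < s by near: s; exact: nbhs_right_gt.
by rewrite subrr normr0 subr0 normrM normfV (@gtr0_norm _ (s - t))// subr_gt0.
Unshelve. all: by end_near. Qed.

Lemma rderiv_slope_le (R : realType) (phi : R -> R) (t v w : R) :
  rderiv phi t v -> v <= w -> rslope_le phi t w.
Proof.
move=> dphi vw e e0.
have : \forall s \near t^'+, (phi s - phi t) / (s - t) < w + e.
  by apply: (cvgr_lt v) => //; lra.
have : \forall s \near t^'+, t < s by exact: nbhs_right_gt.
by apply: filterS2 => s ts; rewrite ltr_pdivrMr ?subr_gt0// => /ltW.
Qed.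

Lemma rslope_leW (R : realType) (phi : R -> R) (t v w : R) :
  rslope_le phi t v -> v <= w -> rslope_le phi t w.
Proof.
move=> dphi vw e e0; have e'0 : 0 < e + (w - v) by lra.
have := dphi _ e'0; apply: filterS => s.
by rewrite (_ : v + _ = w + e)//; ring.
Qed.

Lemma rslope_leD (R : realType) (phi psi : R -> R) (t v w : R) :
  rslope_le phi t v -> rslope_le psi t w ->
  rslope_le (fun s => phi s + psi s) t (v + w).
Proof.
move=> dphi dpsi e e0; have e20 : 0 < e / 2 by rewrite divr_gt0.
have := dpsi _ e20; have := dphi _ e20; apply: filterS2 => s H1 H2.
rewrite (_ : (v + w + e) * (s - t) =
  (v + e / 2) * (s - t) + (w + e / 2) * (s - t)); first lra.
by field.
Qed.

(** A function that is not differentiable inherits the slope of a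
    right-differentiable majorant of its increments; this handles the moving
    target of the Lyapunov function. *)
Lemma rslope_le_majorant (R : realType) (phi psi : R -> R) (t v w : R) :
  0 <= t -> (forall s, 0 <= s -> phi s - phi t <= psi s - psi t) ->
  rderiv psi t v -> v <= w -> rslope_le phi t w.
Proof.
move=> t0 H dpsi vw e e0.
have := rderiv_slope_le dpsi vw e0.
have : \forall s \near t^'+, t < s by exact: nbhs_right_gt.
by apply: filterS2 => s ts; apply: le_trans; apply: H; lra.
Qed.

(** A maximum principle for finite families of functions.  If some member
    exceeded the level, then all of them stay below the slightly tilted line
    [c + eta * (1 + s - T)] up to some last time, at which a member touching
    the line is maximal and larger than [c], hence has too small a slope to
    cross it. *)
Lemma family_barrier (R : realType) (I : finType) (phi : I -> R -> R)
    (c T : R) :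
  0 <= T -> (forall i, cont0y (phi i)) -> (forall i, phi i T <= c) ->
  (forall i t, T <= t -> c < phi i t -> (forall k, phi k t <= phi i t) ->
    rslope_le (phi i) t 0) ->
  forall i t, T <= t -> phi i t <= c.
Proof.
move=> T0 cphi phiT slope.
suff H eta i t : 0 < eta -> T <= t -> phi i t <= c + eta * (1 + (t - T)).
  move=> i t Tt; apply/ler_addgt0Pr => e e0.
  have k0 : 0 < 1 + (t - T) by lra.
  have := H _ i t (divr_gt0 e0 k0) Tt.
  by rewrite mulfVK// gt_eqF.
move=> eta0 Tt; pose line s := c + eta * (1 + (s - T)).
apply: contrapT => /negP; rewrite -ltNge -/(line t) => bad.
pose S := [set s | T <= s /\ forall r, T <= r -> r <= s -> forall k,
  phi k r <= line r].
have ST : S T.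
  split=> // r Tr rT k; have -> : r = T by lra.
  by rewrite (le_trans (phiT k))// /line; nra.
have ubS : ubound S t.
  move=> s [Ts Hs]; rewrite leNgt; apply/negP => /ltW ts.
  by have := Hs t Tt ts i; rewrite leNgt bad.
have supS : has_sup S by split; [exists T|exists t].
set tau := sup S.
have Ttau : T <= tau by apply: sup_upper_bound.
have below r : T <= r -> r < tau -> forall k, phi k r <= line r.
  move=> Tr rtau k; have [s [_ Ss] rs] := @sup_gt _ S r (ex_intro _ T ST) rtau.
  by apply: Ss => //; exact: ltW.
have tauS k : phi k tau <= line tau.
  have [->|TNtau] := eqVneq tau T; first by case: ST => _; apply.
  have {}Ttau : T < tau by rewrite lt_def TNtau.
  have cl : line s @[s --> tau^'-] --> line tau.
    apply: cvgD; first exact: cvg_cst.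
    apply: cvgMl_tmp; apply: cvgD; first exact: cvg_cst.
    by apply: cvgB; [exact: cvg_within|exact: cvg_cst].
  have cp := @cont0y_left _ _ tau (le_lt_trans T0 Ttau) (cphi k).
  apply: (ler_cvg_to cp cl); near=> s; apply: below.
    by near: s; exact: nbhs_left_ge.
  by near: s; exact: nbhs_left_lt.
have tau0 : 0 <= tau by lra.
have /filter_forall beyond : forall k, \forall s \near tau^'+, phi k s <= line s.
  move=> k; have := tauS k; rewrite le_eqVlt => /predU1P[eq|lt].
    have : rslope_le (phi k) tau 0.
      apply: slope => // [|l]; last by rewrite eq.
      by rewrite eq /line; nra.
    move=> /(_ _ eta0); apply: filterS => s.
    by rewrite eq add0r /line => H; nra.
  have cp := @cont0y_right _ _ tau tau0 (cphi k).
  have : \forall s \near tau^'+, phi k s < line tau by exact: cvgr_lt cp _ lt.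
  have : \forall s \near tau^'+, tau < s by exact: nbhs_right_gt.
  by apply: filterS2 => s taus; rewrite /line => H; nra.
have [d /= d0 Hd] := beyond.
suff : S (tau + d / 2).
  by move=> /(sup_upper_bound supS); rewrite -/tau; lra.
split=> [|r Tr rd k]; first lra.
have [rtau|taur|->] := ltgtP r tau; [exact: below| |exact: tauS].
apply: Hd => //=; rewrite /ball_ /= ltr_norml; lra.
Unshelve. all: by end_near. Qed.

Lemma barrier (R : realType) (phi : R -> R) (c T : R) :
  0 <= T -> cont0y phi -> phi T <= c ->
  (forall t, T <= t -> c < phi t -> rslope_le phi t 0) ->
  forall t, T <= t -> phi t <= c.
Proof.
move=> T0 cphi phiT slope t.
by apply: (@family_barrier _ unit (fun=> phi)) => // _ s Ts cs _; exact: slope.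
Qed.

(** * Projection onto a compact convex set of reals *)

Lemma convex_set_comb (R : realType) (K : set R) (p q l : R) :
  convex_set (K : set R^o) -> K p -> K q -> 0 <= l -> l <= 1 ->
  K (l * p + (1 - l) * q).
Proof.
move=> cK Kp Kq l0 l1.
by have := cK p q (Itv01 l0 l1) (mem_set Kp) (mem_set Kq); rewrite inE.
Qed.

Lemma proj_ontoP (R : realType) (K : set R) (v : R) :
  compact K -> K !=set0 ->
  K (proj_onto K v) /\ forall q, K q -> `|v - proj_onto K v| <= `|v - q|.
Proof.
move=> cK K0.
have [|p] := @compact_EVT_min R R (fun p => `|v - p|) K K0 cK.
  apply: continuous_subspaceT => p; apply: cvg_norm.
  by apply: cvgB; [exact: cvg_cst|exact: cvg_id].
rewrite inE => Kp minp; rewrite /proj_onto; case: xgetP => [y _ []//|].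
move=> /(_ p) []; split=> // q Kq; apply: minp; exact/mem_set.
Qed.

Lemma proj_onto_in (R : realType) (K : set R) (v : R) :
  compact K -> K !=set0 -> K (proj_onto K v).
Proof. by move=> cK /(proj_ontoP v cK)[]. Qed.

(** Moving from the projection [p] towards [q] by a fraction [l] changes the
    squared distance to [v] by [l * (l * (q - p)^2 - 2 * (v - p) * (q - p))],
    which must be nonnegative for arbitrarily small [l]. *)
Lemma proj_onto_variational (R : realType) (K : set R) (v q : R) :
  compact K -> K !=set0 -> convex_set (K : set R^o) -> K q ->
  (v - proj_onto K v) * (q - proj_onto K v) <= 0.
Proof.
move=> cK K0 vK Kq; have [Kp minp] := proj_ontoP v cK K0.
set p := proj_onto K v in Kp minp *.
rewrite leNgt; apply/negP => pos.
(* The fraction l below makes l * (q - p) ^+ 2 at most (v - p) * (q - p). *)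
pose d := (q - p) ^+ 2 + (v - p) * (q - p).
have d0 : 0 < d by rewrite /d; have := sqr_ge0 (q - p); lra.
pose l := (v - p) * (q - p) / d.
have l0 : 0 < l by rewrite divr_gt0.
have l1 : l <= 1 by rewrite ler_pdivrMr// mul1r /d lerDr sqr_ge0.
have ld : l * d = (v - p) * (q - p) by rewrite mulfVK// gt_eqF.
have := minp _ (convex_set_comb vK Kq Kp (ltW l0) l1).
rewrite -(@ler_pXn2r _ 2)// ?nnegrE// !real_normK ?num_real//.
have -> : (v - (l * q + (1 - l) * p)) ^+ 2 =
    (v - p) ^+ 2 + l * (l * (q - p) ^+ 2 - 2 * ((v - p) * (q - p))) by ring.
rewrite lerDl pmulr_rge0//.
have : l * (q - p) ^+ 2 <= l * d by rewrite ler_pM2l// /d; lra.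
lra.
Qed.

Lemma convex_between (R : realType) (K : set R) (l u v : R) :
  convex_set (K : set R^o) -> K l -> K u -> l <= v -> v <= u -> K v.
Proof.
move=> vK Kl Ku lv vu; have [lu|ul] := ltP l u; last by have -> : v = l by lra.
have d0 : u - l != 0 by rewrite subr_eq0 gt_eqF.
have -> : v = (u - v) / (u - l) * l + (1 - (u - v) / (u - l)) * u by field.
apply: convex_set_comb => //; first by apply: divr_ge0; lra.
by rewrite ler_pdivrMr; lra.
Qed.

Lemma compact_bounds (R : realType) (K : set R) :
  compact K -> K !=set0 ->
  exists l u : R, [/\ K l, K u & forall v, K v -> l <= v <= u].
Proof.
move=> cK K0.
have cid : {within K, continuous (fun v : R => v)}.
  by apply: continuous_subspaceT => p; exact: cvg_id.
have [l] := compact_EVT_min K0 cK cid; rewrite inE => Kl minl.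
have [u] := compact_EVT_max K0 cK cid; rewrite inE => Ku maxu.
exists l, u; split=> // v Kv.
by rewrite minl ?maxu//; exact/mem_set.
Qed.

(** Trajectories are confined to intervals around the action sets; this turns
    such a confinement into a decomposition into a point of the set and a
    remainder. *)
Lemma proj_onto_dist (R : realType) (K : set R) (v l u xi : R) :
  compact K -> K !=set0 -> convex_set (K : set R^o) -> K l -> K u -> 0 <= xi ->
  l - xi <= v -> v <= u + xi -> `|v - proj_onto K v| <= xi.
Proof.
move=> cK K0 vK Kl Ku xi0 lv vu; have [_ minp] := proj_ontoP v cK K0.
have [vl|lv'] := ltP v l.
  by apply: (le_trans (minp _ Kl)); rewrite ler_norml; lra.
have [uv|vu'] := ltP u v.
  by apply: (le_trans (minp _ Ku)); rewrite ler_norml; lra.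
have Kv := convex_between vK Kl Ku lv' vu'.
by apply: (le_trans (minp _ Kv)); rewrite subrr normr0.
Qed.

(** * The penalty and its gradient *)

Lemma derive_quadratic_remainder (R : realType) N (h : 'rV[R]_N -> R)
    (u v : 'rV[R]_N) (D C : R) :
  (forall s, `|h (s *: v + u) - h u - s * D| <= C * s ^+ 2) -> 'D_v h u = D.
Proof.
move=> hD.
apply: cvg_lim; first exact: Rhausdorff.
have C0 : 0 <= C.
  by have := hD 1; rewrite expr1n mulr1; apply: le_trans.
apply/cvgrPdist_le => e e0; near=> s => /=.
have s0 : s != 0 by near: s; exact: nbhs_dnbhs_neq.
rewrite distrC -(ler_pM2l (_ : 0 < `|s|)) ?normr_gt0//.
rewrite -normrM mulrBr /GRing.scale/= mulrA mulfV// mul1r.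
apply: (le_trans (hD s)).
rewrite -real_normK ?num_real// mulrC expr2 -mulrA ler_pM2l ?normr_gt0//.
have : `|s| <= e / (C + 1).
  by near: s; apply: dnbhs0_le; rewrite divr_gt0//; lra.
rewrite ler_pdivlMr; last lra.
have := normr_ge0 s; nra.
Unshelve. all: by end_near. Qed.

Definition viol (R : realType) (N n : nat) (A : 'M[R]_(n, N)) (b : 'cV[R]_n)
    (v : 'rV[R]_N) (k : 'I_n) : R :=
  Num.max 0 (constraint A b v k 0).

Lemma constraintE (R : realType) (N n : nat) (A : 'M[R]_(n, N)) (b : 'cV[R]_n)
    (v : 'rV[R]_N) k :
  constraint A b v k 0 = \sum_i A k i * v 0 i - b k 0.
Proof.
by rewrite /constraint !mxE; congr (_ - _); apply: eq_bigr => i _; rewrite mxE.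
Qed.

Lemma constraint_comb (R : realType) (N n : nat) (A : 'M[R]_(n, N))
    (b : 'cV[R]_n) (u v : 'rV[R]_N) (s : R) k :
  constraint A b (u + s *: (v - u)) k 0 =
  (1 - s) * constraint A b u k 0 + s * constraint A b v k 0.
Proof.
rewrite !constraintE (_ : \sum_i A k i * (u + s *: (v - u)) 0 i =
  (1 - s) * \sum_i A k i * u 0 i + s * \sum_i A k i * v 0 i); first ring.
rewrite !mulr_sumr -big_split/=; apply: eq_bigr => i _; rewrite !mxE; ring.
Qed.

Lemma penaltyE (R : realType) (N n : nat) (A : 'M[R]_(n, N)) (b : 'cV[R]_n)
    (v : 'rV[R]_N) : penalty A b v = \sum_k viol A b v k ^+ 2.
Proof.
apply: eq_bigr => k _; rewrite /viol.
by case: leP => [g0|/ltW g0]; rewrite ?(max_l g0) ?(max_r g0) ?expr0n.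
Qed.

Lemma sqr_pos_part_remainder (R : realType) (p d : R) :
  `|Num.max 0 (p + d) ^+ 2 - Num.max 0 p ^+ 2 - 2 * Num.max 0 p * d|
    <= d ^+ 2.
Proof.
rewrite ler_norml /Num.max.
by case: (ltP 0 (p + d)); case: (ltP 0 p) => p0 pd; apply/andP; split; nra.
Qed.

Lemma partial_penalty (R : realType) (N n : nat) (A : 'M[R]_(n, N))
    (b : 'cV[R]_n) (v : 'rV[R]_N) i :
  partial i (penalty A b) v = \sum_k 2 * viol A b v k * A k i.
Proof.
apply: (@derive_quadratic_remainder _ _ _ _ _ _ (\sum_k A k i ^+ 2)) => s.
rewrite !penaltyE mulr_sumr mulr_suml -!sumrB.
apply: (le_trans (ler_norm_sum _ _ _)); apply: ler_sum => k _.
have -> : viol A b (s *: delta_mx 0 i + v) k =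
    Num.max 0 (constraint A b v k 0 + s * A k i).
  rewrite /viol !constraintE; congr Num.max.
  rewrite addrAC; congr (_ - _).
  under eq_bigr do rewrite !mxE eqxx/= mulrDr.
  rewrite big_split/= addrC; congr (_ + _).
  rewrite (bigD1 i)//= eqxx mulr1 big1 ?addr0 1?mulrC// => j ji.
  by rewrite (negbTE ji) !mulr0.
have := sqr_pos_part_remainder (constraint A b v k 0) (s * A k i).
by rewrite exprMn -/(viol A b v k) (mulrC (A k i ^+ 2)) mulrCA.
Qed.

Lemma penalty_ge0 (R : realType) (N n : nat) (A : 'M[R]_(n, N))
    (b : 'cV[R]_n) (v : 'rV[R]_N) : 0 <= penalty A b v.
Proof. by rewrite penaltyE; apply: sumr_ge0 => k _; exact: sqr_ge0. Qed.

Lemma penalty_feasible (R : realType) (N n : nat) (A : 'M[R]_(n, N))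
    (b : 'cV[R]_n) (v : 'rV[R]_N) :
  (forall k, constraint A b v k 0 <= 0) -> penalty A b v = 0.
Proof. by move=> gv; rewrite /penalty big1// => k _; rewrite gv. Qed.

Lemma viol_le_penalty (R : realType) (N n : nat) (A : 'M[R]_(n, N))
    (b : 'cV[R]_n) (v : 'rV[R]_N) k : viol A b v k ^+ 2 <= penalty A b v.
Proof.
rewrite penaltyE (bigD1 k)//= lerDl; apply: sumr_ge0 => l _; exact: sqr_ge0.
Qed.

(** Convexity of the penalty, reduced termwise to the tangent inequality
    [2 * q_+ * (p - q) <= p_+ ^ 2 - q_+ ^ 2] for the squared positive part. *)
Lemma grad_penalty_convex (R : realType) (N n : nat) (A : 'M[R]_(n, N))
    (b : 'cV[R]_n) (u v : 'rV[R]_N) :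
  inner (v - u) (grad (penalty A b) u) <= penalty A b v - penalty A b u.
Proof.
rewrite innerE !penaltyE -sumrB.
have -> : \sum_i (v - u) 0 i * grad (penalty A b) u 0 i =
  \sum_k 2 * viol A b u k * (constraint A b v k 0 - constraint A b u k 0).
  under eq_bigr => i _ do rewrite !mxE partial_penalty mulr_sumr.
  rewrite exchange_big/=; apply: eq_bigr => k _.
  rewrite !constraintE opprB addrA subrK -sumrB mulr_sumr.
  by apply: eq_bigr => i _; ring.
apply: ler_sum => k _; rewrite /viol.
move: (constraint A b v k 0) (constraint A b u k 0) => p q.
rewrite -subr_ge0; case: (leP 0 q) => q0; last first.
  by rewrite mulr0 mul0r expr0n !subr0 sqr_ge0.
case: (leP 0 p) => p0.
  by rewrite (_ : _ - _ = (p - q) ^+ 2) ?sqr_ge0//; ring.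
have := mulr_ge0 q0 (ltW (_ : 0 < - p)); rewrite oppr_gt0 => /(_ p0).
by have := sqr_ge0 q; rewrite expr0n /=; nra.
Qed.

Lemma grad_penalty_monotone (R : realType) (N n : nat) (A : 'M[R]_(n, N))
    (b : 'cV[R]_n) : monotone_map (grad (penalty A b)).
Proof.
move=> u v; have Hu := grad_penalty_convex A b u v.
have Hv := grad_penalty_convex A b v u.
move: (grad _ u) (grad _ v) Hu Hv => Gu Gv.
rewrite -(opprB u v) innerNl (innerC _ Gu) (innerC _ Gv) (innerBl Gu); lra.
Qed.

(** * Eigenvalue bounds for symmetric matrices *)

(** The minimum of the Rayleigh quotient over the unit sphere is an
    eigenvalue: the form [v -> v S v - mu |v|^2] is then positive semidefinite
    and vanishes at the minimiser, so its gradient vanishes there. *)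
Lemma symmetric_eigenvalue_lower_bound (R : realType) m (S : 'M[R]_m) (l : R) :
  S^T = S -> (forall mu, eigenvalue S mu -> l <= mu) ->
  forall v : 'rV[R]_m, l * inner v v <= inner (v *m S) v.
Proof.
case: m S => [|m] S symS lS v.
  by rewrite !innerE !big_ord0 mulr0.
pose sphere := [set u : 'rV[R]_m.+1 | inner u u = 1].
have cform (B : 'M[R]_m.+1) : continuous (fun u : 'rV[R]_m.+1 => inner (u *m B) u).
  have -> : (fun u : 'rV[R]_m.+1 => inner (u *m B) u) =
      fun u => \sum_i (\sum_j u 0 j * B j i) * u 0 i.
    by apply/funext => w; rewrite innerE; apply: eq_bigr => i _; rewrite mxE.
  move=> u; apply: (@cvg_sumr _ _ (nbhs u)) => i.
  apply: cvgM; last exact: coord_continuous.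
  apply: (@cvg_sumr _ _ (nbhs u)) => j.
  by apply: cvgM; [exact: coord_continuous|exact: cvg_cst].
have csphere : compact sphere.
  apply: bounded_closed_compact.
    exists 1; split; first exact: num_real.
    move=> r r1 u /= u1; apply: (le_trans (norm_le_enorm u)).
    by rewrite /enorm u1 sqrtr1 ltW.
  have -> : sphere = (fun u : 'rV[R]_m.+1 => inner (u *m 1%:M) u) @^-1` [set 1].
    by apply/seteqP; split => u /=; rewrite mulmx1.
  by apply: closed_comp => [u _|]; [exact: cform|exact: closed_eq].
have sphere0 : sphere !=set0.
  exists (delta_mx 0 0); rewrite /sphere/= innerE (bigD1 0)//= big1 => [|i i0].
    by rewrite !mxE !eqxx mulr1 addr0.
  by rewrite !mxE (negbTE i0) mulr0.
have [e] := EVT_min_rV sphere0 csphere (continuous_subspaceT (cform S)).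
rewrite inE /sphere/= => e1 mine.
pose mu := inner (e *m S) e.
have psd u : mu * inner u u <= inner (u *m S) u.
  have [u0|u0] := eqVneq (inner u u) 0.
    have -> : u = 0 by apply: inner_self_eq0; rewrite u0.
    by rewrite mul0mx !inner0l mulr0.
  have nu : 0 < enorm u by rewrite sqrtr_gt0 lt_def u0 inner_ge0.
  have /mine : (enorm u)^-1 *: u \in [set u : 'rV[R]_m.+1 | inner u u = 1].
    by rewrite inE /= innerZl innerZr -enorm_sqr; field; rewrite gt_eqF.
  rewrite -/mu -scalemxAl innerZl innerZr -enorm_sqr.
  rewrite -(ler_pM2l (exprn_gt0 2 nu)) mulrC.
  by rewrite (_ : _ ^+ 2 * _ = inner (u *m S) u)//; field; rewrite gt_eqF.
suff eig : e *m S = mu *: e.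
  apply: (le_trans _ (psd v)); apply: ler_wpM2r; first exact: inner_ge0.
  apply: lS; apply/eigenvalueP; exists e => //.
  by apply: contra_eq_neq e1 => ->; rewrite inner0l eq_sym oner_eq0.
have [w wE] : exists w, w = e *m S - mu *: e by exists (e *m S - mu *: e).
have symq u u' : inner (u *m S) u' = inner u (u' *m S).
  by rewrite /inner trmx_mul symS mulmxA.
have qw s : 0 <= s * (2 * inner w w + s * (inner (w *m S) w - mu * inner w w)).
  have := psd (e + s *: w).
  rewrite !mulmxDl -!scalemxAl !innerDl !innerDr !innerZl !innerZr e1 -/mu.
  have -> : inner (w *m S) e = inner (e *m S) w by rewrite symq innerC.
  have -> : inner (e *m S) w = inner w w + mu * inner e w.
    by rewrite -innerZl -innerDl wE subrK.
  rewrite (innerC w e); nra.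
apply/eqP; rewrite -subr_eq0 -wE; apply/eqP; apply: inner_self_eq0.
rewrite leNgt; apply/negP => w0.
set k := inner (w *m S) w - mu * inner w w in qw.
(* A small negative s, for which the linear term of qw dominates. *)
pose s := - (inner w w / (1 + `|k|)).
have k0 : 0 < 1 + `|k| by have := normr_ge0 k; lra.
have s0 : s < 0 by rewrite oppr_lt0 divr_gt0.
have sk : `|s * k| <= inner w w.
  rewrite normrM (ltr0_norm s0) opprK -mulrA ler_piMr ?(ltW w0)//.
  by rewrite mulrC ler_pdivrMr//; lra.
have := qw s; rewrite nmulr_rge0//.
by move: sk; rewrite ler_norml; lra.
Qed.

(** * Regularised and penalised variational inequalities *)

(** The regularisation contributes [d * |u - v|^2]; the other two parts of the
    map are monotone. *)
Lemma Phi_de_strongly_monotone (R : realType) (N n : nat)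
    (f : 'I_N -> 'rV[R]_N -> R) (A : 'M[R]_(n, N)) (b : 'cV[R]_n) (d e : R)
    (u v : 'rV[R]_N) :
  monotone_map (pseudo_gradient f) -> 0 <= e ->
  d * inner (u - v) (u - v) <=
  inner (Phi_de f A b d e u - Phi_de f A b d e v) (u - v).
Proof.
move=> monoF e0.
have -> : Phi_de f A b d e u - Phi_de f A b d e v =
    (pseudo_gradient f u - pseudo_gradient f v) + d *: (u - v)
    + e *: (grad (penalty A b) u - grad (penalty A b) v).
  rewrite /Phi_de; move: (pseudo_gradient f u) (pseudo_gradient f v) => p q.
  move: (grad _ u) (grad _ v) => Gu Gv.
  by apply/rowP => i; rewrite !mxE; ring.
have := mulr_ge0 e0 (grad_penalty_monotone A b u v); have := monoF u v.
move: (u - v) (pseudo_gradient f u - _) (grad _ u - _) => w p q.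
rewrite 2!innerDl 2!innerZl; lra.
Qed.

(** Testing each inequality with the solution of the other one and adding, the
    strong monotonicity of the first map bounds the distance of the solutions
    by the difference of the two maps at [v]. *)
Lemma VI_Phi_de_lipschitz (R : realType) (N n : nat)
    (f : 'I_N -> 'rV[R]_N -> R) (A : 'M[R]_(n, N)) (b : 'cV[R]_n)
    (K : set 'rV[R]_N) (d e d' e' cx cp : R) (u v : 'rV[R]_N) :
  monotone_map (pseudo_gradient f) -> 0 <= e ->
  VI K (Phi_de f A b d e) u -> VI K (Phi_de f A b d' e') v ->
  enorm v <= cx -> enorm (grad (penalty A b) v) <= cp ->
  d * enorm (u - v) <= Num.max cx cp * (`|d' - d| + `|e' - e|).
Proof.
move=> monoF e0 [Ku VIu] [Kv VIv] vx vp.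
have := Phi_de_strongly_monotone A b d u v monoF e0.
set Phi := Phi_de f A b d e.
have -> : Phi u - Phi v = Phi u - Phi_de f A b d' e' v
    + ((d' - d) *: v + (e' - e) *: grad (penalty A b) v).
  rewrite /Phi /Phi_de; move: (pseudo_gradient f u) (pseudo_gradient f v) => p q.
  move: (grad _ u) (grad _ v) => Gu Gv.
  by apply/rowP => i; rewrite !mxE; ring.
have : inner (Phi u - Phi_de f A b d' e' v) (u - v) <= 0.
  have := VIu _ Kv; have := VIv _ Ku.
  rewrite -/Phi; move: (Phi u) (Phi_de _ _ _ _ _ _) => p q.
  rewrite -(opprB u v) innerNl (innerBl p) !(innerC (u - v)); lra.
set w := _ *: _ + _ *: _.
have : inner w (u - v) <= Num.max cx cp * (`|d' - d| + `|e' - e|) * enorm (u - v).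
  apply: (le_trans (inner_le_enorm _ _)); apply: ler_wpM2r; first exact: enorm_ge0.
  apply: (le_trans (enorm_triangle _ _)).
  have enormZ a (z : 'rV[R]_N) : enorm (a *: z) = `|a| * enorm z.
    rewrite /enorm innerZl innerZr mulrA -expr2 sqrtrM ?sqr_ge0//.
    by rewrite sqrtr_sqr.
  rewrite 2!enormZ mulrDr ![Num.max _ _ * _]mulrC.
  by apply: lerD; apply: ler_wpM2l => //; rewrite le_max ?vx ?vp ?orbT.
rewrite (innerDl (Phi u - _)) -enorm_sqr.
have := enorm_ge0 (u - v); rewrite le_eqVlt => /predU1P[<- _ _ _|uv].
  rewrite mulr0 mulr_ge0 ?addr_ge0// le_max (le_trans _ vx)//.
  exact: enorm_ge0.
move=> H1 H2 H3; rewrite -(ler_pM2r uv); lra.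
Qed.

Lemma slater_margin (R : realType) (N n : nat) (A : 'M[R]_(n, N))
    (b : 'cV[R]_n) (v : 'rV[R]_N) :
  (forall k, constraint A b v k 0 < 0) ->
  exists2 sigma : R, 0 < sigma & forall k, constraint A b v k 0 <= - sigma.
Proof.
move=> gv.
have /filter_forall H : forall k, \forall s \near (0 : R)^'+,
    constraint A b v k 0 <= - s.
  move=> k; have k0 : 0 < - constraint A b v k 0 by rewrite oppr_gt0.
  near=> s; rewrite lerNr.
  by near: s; exact: nbhs_right_le.
near (0 : R)^'+ => s; exists s => //.
by near: s.
Unshelve. all: by end_near. Qed.

(** For [l = v / (v + sigma)] an affine constraint is at most
    [(1 - l) * v - l * sigma = 0] at the combination. *)
Lemma near_feasible (R : realType) (N n : nat) (Om : 'I_N -> set R)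
    (A : 'M[R]_(n, N)) (b : 'cV[R]_n) (u z : 'rV[R]_N) (sigma v : R) :
  (forall i, convex_set (Om i : set R^o)) ->
  action_set Om u -> action_set Om z -> 0 < sigma -> 0 <= v ->
  (forall k, constraint A b z k 0 <= - sigma) ->
  (forall k, constraint A b u k 0 <= v) ->
  feasible_set Om A b (u + (v / (v + sigma)) *: (z - u)).
Proof.
move=> Omc Omu Omz s0 v0 gz gu; have vs : 0 < v + sigma by lra.
have l0 : 0 <= v / (v + sigma) by apply: divr_ge0; lra.
have l1 : v / (v + sigma) <= 1 by rewrite ler_pdivrMr//; lra.
split=> [i|k].
  rewrite (_ : _ 0 i = v / (v + sigma) * z 0 i + (1 - v / (v + sigma)) * u 0 i).
    exact: convex_set_comb.
  by rewrite !mxE; ring.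
rewrite constraint_comb.
have H1 := ler_wpM2l l0 (gz k).
have H2 : (1 - v / (v + sigma)) * constraint A b u k 0 <=
    (1 - v / (v + sigma)) * v by apply: ler_wpM2l => //; lra.
apply: (le_trans (lerD H2 H1)).
by rewrite le_eqVlt; apply/orP; left; apply/eqP; field; rewrite gt_eqF.
Qed.

(** The penalised solution [u] almost solves the constrained problem.  Testing
    its variational inequality with feasible points bounds [e * penalty u];
    testing the inequality of [xs] with the feasible point near [u] bounds the
    alignment of [u] with [u - xs]. *)
Lemma penalized_solution_estimates (R : realType) (N n : nat)
    (f : 'I_N -> 'rV[R]_N -> R) (Om : 'I_N -> set R)
    (A : 'M[R]_(n, N)) (b : 'cV[R]_n) (cx : R) (xs : 'rV[R]_N) :
  monotone_map (pseudo_gradient f) ->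
  (forall i, convex_set (Om i : set R^o)) -> slater Om A b ->
  (forall v, action_set Om v -> enorm v <= cx) ->
  variational_equilibrium f Om A b xs ->
  exists2 C : R, 0 < C & forall d e u, 0 < d -> d <= 1 -> 0 < e ->
    VI (action_set Om) (Phi_de f A b d e) u ->
    [/\ forall k, e * viol A b u k ^+ 2 <= C,
        forall v, 0 <= v -> (forall k, constraint A b u k 0 <= v) ->
          d * inner u (u - xs) <= C * v
      & forall q, feasible_set Om A b q ->
          - inner (q - u) (pseudo_gradient f u) <= C * d].
Proof.
move=> monoF Omc [z Omz gz] bx [[Omxs gxs] VIxs].
have [sigma s0 gzs] := slater_margin gz.
set F := pseudo_gradient f in monoF VIxs *.
have M0 := enorm_ge0 (F xs).
have cx0 : 0 <= cx by apply: le_trans (enorm_ge0 _) (bx _ Omxs).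
have sM0 : 0 <= cx * enorm (F xs) / sigma by rewrite divr_ge0 ?mulr_ge0// ltW.
exists (2 * (cx * enorm (F xs)) + 2 * (cx * cx)
  + 2 * (cx * enorm (F xs) / sigma) + 1).
  by have := mulr_ge0 cx0 M0; have := mulr_ge0 cx0 cx0; lra.
have cM0 := mulr_ge0 cx0 M0; have cc0 := mulr_ge0 cx0 cx0.
move=> d e u d0 d1 e0 [Omu VIu].
have diam p q w : action_set Om p -> action_set Om q ->
    inner (p - q) w <= 2 * (cx * enorm w).
  move=> Op Oq; apply: (le_trans (inner_le_enorm _ _)).
  rewrite mulrA; apply: ler_wpM2r; first exact: enorm_ge0.
  by apply: (le_trans (enormB _ _)); have := bx _ Op; have := bx _ Oq; lra.
have diamu p : action_set Om p -> inner (p - u) u <= 2 * (cx * cx).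
  move=> Op; apply: (le_trans (diam _ _ _ Op Omu)).
  by rewrite ler_pM2l// ler_wpM2l// bx.
have test q : feasible_set Om A b q ->
    e * penalty A b u <= inner (q - u) (F u) + d * inner (q - u) u.
  move=> [Oq gq]; have := VIu _ Oq; rewrite /Phi_de -/F 2!innerDr 2!innerZr.
  have := ler_wpM2l (ltW e0) (grad_penalty_convex A b u q).
  rewrite (penalty_feasible gq); lra.
have mono : inner (xs - u) (F u) <= inner (xs - u) (F xs).
  have := monoF xs u; move: (F xs) (F u) => p q.
  by rewrite (innerBl p) !(innerC (xs - u)); lra.
have P0 := mulr_ge0 (ltW e0) (penalty_ge0 A b u).
have tests := test xs (conj Omxs gxs).
split=> [k|v v0 gu|q fq].
- have := ler_wpM2l (ltW e0) (viol_le_penalty A b u k).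
  have := diam _ _ (F xs) Omxs Omu.
  have : d * inner (xs - u) u <= 2 * (cx * cx).
    apply: (@le_trans _ _ (d * (2 * (cx * cx)))); first by rewrite ler_pM2l// diamu.
    by rewrite ler_piMl//; lra.
  lra.
- have fq := near_feasible Omc Omu Omz s0 v0 gzs gu.
  set s := v / (v + sigma) in fq.
  have := VIxs _ fq.
  have -> : u + s *: (z - u) - xs = s *: (z - u) - (xs - u).
    by apply/rowP => i; rewrite !mxE; ring.
  rewrite innerBl innerZl.
  have : s * inner (z - u) (F xs) <= v * (2 * (cx * enorm (F xs) / sigma)).
    apply: (@le_trans _ _ (s * (2 * (cx * enorm (F xs))))).
      apply: ler_wpM2l; last exact: diam.
      by rewrite divr_ge0//; lra.
    rewrite (_ : v * _ = v / sigma * (2 * (cx * enorm (F xs)))); last first.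
      by field; rewrite gt_eqF.
    apply: ler_wpM2r; first lra.
    by apply: ler_wpM2l => //; rewrite lef_pV2 ?posrE//; lra.
  have : d * inner u (u - xs) = - (d * inner (xs - u) u).
    by rewrite innerC -(opprB xs u) innerNl mulrN.
  have := mulr_ge0 v0 cM0; have := mulr_ge0 v0 cc0; nra.
- have [Oq _] := fq; have := test q fq.
  have : d * inner (q - u) u <= d * (2 * (cx * cx)) by rewrite ler_pM2l// diamu.
  have := mulr_ge0 (ltW d0) cM0; have := mulr_ge0 (ltW d0) sM0; nra.
Qed.

(** The rates of the penalty estimates: [h] will be [eps] or [delta ^+ 2 * eps]. *)
Lemma sqrt_div_cvg0 (R : realType) (h : R -> R) (C : R) :
  0 < C -> h t @[t --> +oo] --> +oo ->
  Num.sqrt (C / h t) @[t --> +oo] --> (0 : R).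
Proof.
move=> C0 hoo; apply/cvgrPdist_le => e e0; near=> t.
rewrite sub0r normrN ger0_norm ?sqrtr_ge0//.
rewrite -(@ler_pXn2r _ 2)// ?nnegrE ?sqrtr_ge0 ?(ltW e0)//.
have ht : C / e ^+ 2 <= h t by near: t; exact: cvgry_ge.
have e20 : 0 < e ^+ 2 by rewrite exprn_gt0.
have h0 : 0 < h t by apply: lt_le_trans ht; rewrite divr_gt0.
rewrite sqr_sqrtr; last by rewrite divr_ge0// ltW.
by rewrite ler_pdivrMr// mulrC -ler_pdivrMr.
Unshelve. all: by end_near. Qed.

Lemma cluster_le (R : realType) (T : topologicalType) (u : R -> T)
    (g : T -> R) (h : R -> R) (l : R) (p : T) :
  continuous g -> (\forall t \near +oo, g (u t) <= h t) ->
  h t @[t --> +oo] --> l -> cluster (u t @[t --> +oo]) p -> g p <= l.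
Proof.
move=> cg gh hl clp; apply/ler_addgt0Pr => e e0.
have cl : closed [set v | g v <= l + e].
  apply: (@closed_comp _ _ g [set r | r <= l + e]) => [v _|]; first exact: cg.
  exact: closed_le.
suff : closure [set v | g v <= l + e] p by rewrite -(closure_id _).1.
rewrite clusterE in clp; apply: clp.
rewrite /= /fmap/=; near=> t => /=.
apply: (@le_trans _ _ (h t)); first by near: t.
by near: t; apply: (cvgr_le l) => //; rewrite ltrDl.
Unshelve. all: by end_near. Qed.

Lemma cluster_closed (R : realType) (T : topologicalType) (u : R -> T)
    (K : set T) (p : T) :
  closed K -> (\forall t \near +oo, K (u t)) ->
  cluster (u t @[t --> +oo]) p -> K p.
Proof.
move=> cK uK; rewrite clusterE => /(_ K uK).
by rewrite -(closure_id _).1.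
Qed.

Lemma closed_action_set (R : realType) (N : nat) (Om : 'I_N -> set R) :
  (forall i, compact (Om i)) -> closed (action_set Om).
Proof.
move=> cOm.
have -> : action_set Om =
    \bigcap_(i in [set: 'I_N]) ((fun v : 'rV[R]_N => v 0 i) @^-1` Om i).
  by apply/seteqP; split=> [v Ov i _|v Ov i]; [exact: Ov|exact: Ov].
apply: closed_bigI => i _; apply: closed_comp => [v _|].
  exact: coord_continuous.
by apply: compact_closed => //; exact: Rhausdorff.
Qed.

Lemma inner_continuous (R : realType) (N : nat) (p q : 'rV[R]_N -> 'rV[R]_N) :
  (forall i, continuous (fun v => p v 0 i)) ->
  (forall i, continuous (fun v => q v 0 i)) ->
  continuous (fun v => inner (p v) (q v)).
Proof.
move=> cp cq.
rewrite (_ : (fun v => _) = fun v => \sum_i p v 0 i * q v 0 i); last first.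
  by apply/funext => v; rewrite innerE.
by move=> v; apply: (@cvg_sumr _ _ (nbhs v)) => i; apply: cvgM; [exact: cp|exact: cq].
Qed.

(** Every cluster point [p] of the penalised solutions is feasible, solves the
    constrained inequality, and satisfies [inner p (p - xstar) <= 0]; together
    with the minimality of [|xstar|] the latter forces [p = xstar]. *)
Lemma regularized_solutions_cvg (R : realType) (N n : nat)
    (f : 'I_N -> 'rV[R]_N -> R) (Om : 'I_N -> set R)
    (A : 'M[R]_(n, N)) (b : 'cV[R]_n) (cx : R) (xstar : 'rV[R]_N)
    (delta eps : R -> R) (xt : R -> 'rV[R]_N) :
  (forall i, continuous (partial i (f i))) ->
  monotone_map (pseudo_gradient f) ->
  (forall i, convex_set (Om i : set R^o)) -> (forall i, compact (Om i)) ->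
  slater Om A b ->
  (forall v, action_set Om v -> enorm v <= cx) ->
  least_norm_in (variational_equilibrium f Om A b) xstar ->
  (forall t, 0 <= t -> 0 < delta t) -> (forall t, 0 <= t -> 0 < eps t) ->
  (forall t : R, 0 <= t ->
    VI (action_set Om) (Phi_de f A b (delta t) (eps t)) (xt t)) ->
  delta t @[t --> +oo] --> 0 ->
  delta t ^+ 2 * eps t @[t --> +oo] --> +oo ->
  eps t @[t --> +oo] --> +oo ->
  xt t @[t --> +oo] --> xstar.
Proof.
move=> cF monoF Omc Omk slat bx [VExs minxs] dpos epos xtP d0 d2e eoo.
have [C C0 est] := penalized_solution_estimates monoF Omc slat bx VExs.
have tge : \forall t \near +oo, (0 : R) <= t by exact: nbhs_pinfty_ge.
have dle1 : \forall t \near +oo, delta t <= 1.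
  by apply: (cvgr_le 0) => //; exact: ltr01.
have estt : \forall t \near +oo,
    [/\ forall k, eps t * viol A b (xt t) k ^+ 2 <= C,
        forall v, 0 <= v -> (forall k, constraint A b (xt t) k 0 <= v) ->
          delta t * inner (xt t) (xt t - xstar) <= C * v
      & forall q, feasible_set Om A b q ->
          - inner (q - xt t) (pseudo_gradient f (xt t)) <= C * delta t].
  near=> t; apply: (est _ (eps t)).
  - by apply: dpos; near: t.
  - by near: t.
  - by apply: epos; near: t.
  - by apply: xtP; near: t.
have gsqrt : \forall t \near +oo, forall k,
    constraint A b (xt t) k 0 <= Num.sqrt (C / eps t).
  near=> t => k.
  have et : 0 < eps t by apply: epos; near: t.
  have [H _ _] : [/\ forall k, eps t * viol A b (xt t) k ^+ 2 <= C,
        forall v, 0 <= v -> (forall k, constraint A b (xt t) k 0 <= v) ->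
          delta t * inner (xt t) (xt t - xstar) <= C * v
      & forall q, feasible_set Om A b q ->
          - inner (q - xt t) (pseudo_gradient f (xt t)) <= C * delta t].
    by near: t.
  apply: (@le_trans _ _ (viol A b (xt t) k)); first by rewrite le_max lexx orbT.
  have v0 : 0 <= viol A b (xt t) k by rewrite le_max lexx.
  rewrite -(@ler_pXn2r _ 2)// ?nnegrE ?sqrtr_ge0// sqr_sqrtr.
    by rewrite ler_pdivlMr// mulrC.
  by rewrite divr_ge0// ltW.
have coordc i : continuous (fun v : 'rV[R]_N => v 0 i).
  exact: coord_continuous.
have cg k : continuous (fun v : 'rV[R]_N => constraint A b v k 0).
  have -> : (fun v : 'rV[R]_N => constraint A b v k 0) =
      fun v => \sum_i A k i * v 0 i - b k 0.
    by apply/funext => v; rewrite constraintE.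
  move=> v; apply: (@cvgB _ _ _ (nbhs v)); last exact: cvg_cst.
  apply: (@cvg_sumr _ _ (nbhs v)) => i; apply: cvgM; first exact: cvg_cst.
  exact: coordc.
have cBr (q : 'rV[R]_N) i : continuous (fun v : 'rV[R]_N => (q - v) 0 i).
  have -> : (fun v : 'rV[R]_N => (q - v) 0 i) = fun v => q 0 i - v 0 i.
    by apply/funext => w; rewrite !mxE.
  by move=> v; apply: (@cvgB _ _ _ (nbhs v)); [exact: cvg_cst|exact: coordc].
have cBl (q : 'rV[R]_N) i : continuous (fun v : 'rV[R]_N => (v - q) 0 i).
  have -> : (fun v : 'rV[R]_N => (v - q) 0 i) = fun v => v 0 i - q 0 i.
    by apply/funext => w; rewrite !mxE.
  by move=> v; apply: (@cvgB _ _ _ (nbhs v)); [exact: coordc|exact: cvg_cst].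
have cPsi i : continuous (fun v => pseudo_gradient f v 0 i).
  have -> : (fun v => pseudo_gradient f v 0 i) = partial i (f i).
    by apply/funext => w; rewrite mxE.
  exact: cF.
have clP p : cluster (xt t @[t --> +oo]) p -> p = xstar.
  move=> clp.
  have Op : action_set Om p.
    apply: (cluster_closed (closed_action_set Omk) _ clp).
    by near=> t; have /xtP[] : 0 <= t by near: t.
  have gp k : constraint A b p k 0 <= 0.
    apply: (@cluster_le _ _ _ (fun v => constraint A b v k 0) _ _ _ _ _
      (sqrt_div_cvg0 C0 eoo) clp).
      exact: cg.
    by near=> t; move: k; near: t.
  have VIp : variational_equilibrium f Om A b p.
    split=> // q fq; rewrite -oppr_le0.
    apply: (@cluster_le R 'rV[R]_N xt (fun v => - inner (q - v) (pseudo_gradient f v))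
      (fun t => C * delta t) 0 p _ _ _ clp).
    - move=> v; apply: (@cvgN _ _ _ (nbhs v)).
      by apply: (inner_continuous (p := fun w => q - w)); [exact: cBr|exact: cPsi].
    - by apply: filterS estt => t [_ _]; apply.
    - by rewrite -[X in _ --> X](mulr0 C); apply: cvgM => //; exact: cvg_cst.
  have pxs : inner p (p - xstar) <= 0.
    apply: (@cluster_le R 'rV[R]_N xt (fun v => inner v (v - xstar))
      (fun t => C * Num.sqrt (C / (delta t ^+ 2 * eps t))) 0 p _ _ _ clp).
    - by apply: inner_continuous => i; [exact: coordc|exact: cBl].
    - apply: filterS3 tge estt gsqrt => t t0 [_ H _] Hk.
      have dt := dpos t t0; have et := epos t t0.
      have := H _ (sqrtr_ge0 _) Hk; rewrite -ler_pdivlMl// => /le_trans; apply.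
      rewrite (_ : C / (_ * _) = ((delta t)^-1) ^+ 2 * (C / eps t)); last first.
        by field; rewrite !gt_eqF.
      rewrite (@sqrtrM _ (_ ^+ 2)) ?sqr_ge0// sqrtr_sqr gtr0_norm ?invr_gt0//.
      by rewrite mulrCA.
    - rewrite -[X in _ --> X](mulr0 C); apply: cvgM; first exact: cvg_cst.
      exact: sqrt_div_cvg0.
  apply/eqP; rewrite -subr_eq0; apply/eqP; apply: inner_self_eq0.
  have := minxs _ VIp; rewrite -(@ler_pXn2r _ 2)// ?nnegrE ?enorm_ge0//.
  rewrite !enorm_sqr; move: pxs.
  by rewrite !innerBl !innerBr (innerC xstar p); lra.
pose V := [set v : 'rV[R]_N | `|v| <= cx + 1].
have cV : compact V.
  apply: bounded_closed_compact.
    exists (cx + 1); split; first exact: num_real.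
    by move=> r cr v /= /le_trans; apply; exact: ltW.
  apply: (@closed_comp _ _ (fun v : 'rV[R]_N => `|v|) [set r | r <= cx + 1]) => [v _|].
    exact: norm_continuous.
  exact: closed_le.
have FV : \forall t \near +oo, V (xt t).
  near=> t; rewrite /V/=; apply: (le_trans (norm_le_enorm _)).
  have /xtP[/bx xb _] : 0 <= t by near: t.
  by lra.
apply: (compact_cluster_set1 _ cV).
- exact: norm_hausdorff.
- have xs1 : `|xstar| < cx + 1.
    apply: (le_lt_trans (norm_le_enorm _)).
    by have [[Ox _] _] := VExs; have := bx _ Ox; lra.
  have := @norm_continuous _ _ xstar.
  by move=> /cvgr_le; apply.
- exact: FV.
- apply/seteqP; split=> [p /clP //|_ ->].
  have [p [_ clp]] := cV (xt t @[t --> +oo]) _ FV.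
  by have <- := clP p clp.
Unshelve. all: by end_near. Qed.

(** * A priori bounds along trajectories *)

(** Above a level that bounds the target [p] the velocity points downwards. *)
Lemma relaxation_le (R : realType) (phi p vsigma : R -> R) (c : R) :
  cont0y phi ->
  (forall t, 0 <= t -> rderiv phi t (vsigma t * (p t - phi t))) ->
  (forall t, 0 <= t -> 0 < vsigma t) -> (forall t, 0 <= t -> p t <= c) ->
  phi 0 <= c -> forall t, 0 <= t -> phi t <= c.
Proof.
move=> cphi dphi s0 pc phi0; apply: barrier => // t t0 cphit.
apply: (rderiv_slope_le (dphi t t0)); rewrite pmulr_rle0 ?s0//.
by have := pc t t0; lra.
Qed.

Lemma relaxation_ge (R : realType) (phi p vsigma : R -> R) (c : R) :
  cont0y phi ->
  (forall t, 0 <= t -> rderiv phi t (vsigma t * (p t - phi t))) ->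
  (forall t, 0 <= t -> 0 < vsigma t) -> (forall t, 0 <= t -> c <= p t) ->
  c <= phi 0 -> forall t, 0 <= t -> c <= phi t.
Proof.
move=> cphi dphi s0 pc phi0 t t0; rewrite -lerN2.
apply: (@relaxation_le _ (fun s => - phi s) (fun s => - p s) vsigma) => //.
- exact: cont0yN.
- by move=> s s00; rewrite opprK addrC -opprB mulrN; apply: rderivN; exact: dphi.
- by move=> s /pc; rewrite lerN2.
- by rewrite lerN2.
Qed.

(** A follower [i] whose estimate is the largest of all is pulled down by its
    neighbours, so only the leader [j] could raise the maximum. *)
Lemma consensus_le (R : realType) (N : nat) (a : 'M[R]_N) (w : R -> R)
    (phi : 'I_N -> R -> R) (j : 'I_N) (c : R) :
  (forall i k, 0 <= a i k) -> (forall t, 0 <= t -> 0 < w t) ->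
  (forall i, cont0y (phi i)) ->
  (forall t i, 0 <= t -> i != j ->
     rderiv (phi i) t (- w t * \sum_k a i k * (phi i t - phi k t))) ->
  (forall t, 0 <= t -> phi j t <= c) -> (forall i, phi i 0 <= c) ->
  forall i t, 0 <= t -> phi i t <= c.
Proof.
move=> a0 w0 cphi dphi phij phi0; apply: family_barrier => // i t t0 ct maxi.
have [ij|ij] := eqVneq i j; first by move: ct; rewrite ij ltNge phij.
apply: (rderiv_slope_le (dphi t i t0 ij)).
rewrite mulNr oppr_le0 mulr_ge0 ?(ltW (w0 t t0))//.
by apply: sumr_ge0 => k _; rewrite mulr_ge0// subr_ge0.
Qed.

Lemma consensus_ge (R : realType) (N : nat) (a : 'M[R]_N) (w : R -> R)
    (phi : 'I_N -> R -> R) (j : 'I_N) (c : R) :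
  (forall i k, 0 <= a i k) -> (forall t, 0 <= t -> 0 < w t) ->
  (forall i, cont0y (phi i)) ->
  (forall t i, 0 <= t -> i != j ->
     rderiv (phi i) t (- w t * \sum_k a i k * (phi i t - phi k t))) ->
  (forall t, 0 <= t -> c <= phi j t) -> (forall i, c <= phi i 0) ->
  forall i t, 0 <= t -> c <= phi i t.
Proof.
move=> a0 w0 cphi dphi phij phi0 i t t0; rewrite -lerN2.
apply: (@consensus_le _ _ a w (fun i s => - phi i s) j) => //.
- by move=> k; exact: cont0yN.
- move=> s k s0 kj; rewrite (_ : _ * _ =
    - (- w s * \sum_l a k l * (phi k s - phi l s))).
    by apply: rderivN; exact: dphi.
  rewrite -mulrN -sumrN; congr (_ * _); apply: eq_bigr => l _; ring.
- by move=> s s0; rewrite lerN2 phij.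
- by move=> k; rewrite lerN2.
Qed.

Lemma sum_Yhat (R : realType) (N : nat) (x : 'rV[R]_N) (y : 'M[R]_N) (i : 'I_N) :
  y i i = x 0 i ->
  inner (Yhat x y i) (Yhat x y i) = \sum_j (y j i - x 0 i) ^+ 2.
Proof.
move=> yii; rewrite -enorm_sqr enorm_sum.
rewrite [RHS](@bigD1_ord _ _ _ _ i)//= yii subrr expr0n add0r.
by apply: eq_bigr => j _; rewrite mxE.
Qed.

(** The diagonal terms, absent from [zvec], vanish because an agent knows its own
    action. *)
Lemma enorm_zvec (R : realType) (N : nat) (x : 'rV[R]_N) (y : 'M[R]_N)
    (xs : 'rV[R]_N) :
  (forall i, y i i = x 0 i) ->
  enorm (zvec x y xs) ^+ 2 =
  enorm (x - xs) ^+ 2 + \sum_i \sum_j (y j i - x 0 i) ^+ 2.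
Proof.
move=> yii; rewrite !enorm_sqr /zvec /inner tr_row_mx mul_row_col mxE.
congr (_ + _); rewrite tr_mxrow mul_mxrow_mxcol summxE.
by apply: eq_bigr => i _; rewrite -sum_Yhat.
Qed.

(** The coordinate [i] of an action relaxes towards [Om i], and the estimates
    of [x_i] follow a consensus led by [x_i]; by the maximum principle neither
    leaves the enlargement of [Om i] by the initial errors.  The dynamics of the
    actions enters only through the projection ranging in [Om i]. *)
Lemma trajectory_bounds (R : realType) (N : nat) (Om : 'I_N -> set R)
    (a : 'M[R]_N) (vsigma w : R -> R) (x : R -> 'rV[R]_N) (y : R -> 'M[R]_N)
    (p : R -> 'rV[R]_N) (xs : 'rV[R]_N) (cx : R) :
  (forall i, convex_set (Om i : set R^o)) -> (forall i, compact (Om i)) ->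
  (forall v, action_set Om v -> enorm v <= cx) -> action_set Om xs ->
  (forall i k, 0 <= a i k) -> (forall t, 0 <= t -> 0 < vsigma t) ->
  (forall t, 0 <= t -> 0 < w t) ->
  (forall i, cont0y (fun s => x s 0 i)) ->
  (forall i j, cont0y (fun s => y s i j)) ->
  (forall t, 0 <= t -> action_set Om (p t)) ->
  (forall t i, 0 <= t ->
    rderiv (fun s => x s 0 i) t (vsigma t * (p t 0 i - x t 0 i))) ->
  (forall t i j, 0 <= t -> i != j ->
    rderiv (fun s => y s i j) t
      (- w t * \sum_k a i k * (y t i j - y t k j))) ->
  (forall t, 0 <= t -> forall i, y t i i = x t 0 i) ->
  forall t, 0 <= t -> enorm (x t) <= enorm (zvec (x 0) (y 0) xs) + cx /\
    forall i, enorm (row i (y t)) <= 2 * enorm (zvec (x 0) (y 0) xs) + cx.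
Proof.
move=> Omc Omk bx Oxs a0 s0 w0 contx conty Op dx dy yii t t0.
have Om0 i : Om i !=set0 by exists (xs 0 i).
have z0 : enorm (zvec (x 0) (y 0) xs) ^+ 2 = _ := enorm_zvec xs (yii 0 (lexx 0)).
set z := enorm _ in z0 *.
have zge0 : 0 <= z by exact: enorm_ge0.
pose xi i := `|x 0 0 i - xs 0 i|.
pose eta i := Num.sqrt (\sum_j (y 0 j i - x 0 0 i) ^+ 2).
have sum_xi : \sum_i xi i ^+ 2 = enorm (x 0 - xs) ^+ 2.
  by rewrite enorm_sum; apply: eq_bigr => i _; rewrite /xi real_normK ?num_real// !mxE.
have sum_eta : \sum_i eta i ^+ 2 = \sum_i \sum_j (y 0 j i - x 0 0 i) ^+ 2.
  apply: eq_bigr => i _; rewrite sqr_sqrtr//.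
  by apply: sumr_ge0 => j _; exact: sqr_ge0.
have eta_ge j i : `|y 0 j i - x 0 0 i| <= eta i.
  rewrite -(@ler_pXn2r _ 2)// ?nnegrE ?sqrtr_ge0// sqr_sqrtr.
    rewrite real_normK ?num_real// (bigD1 j)//= lerDl.
    by apply: sumr_ge0 => k _; exact: sqr_ge0.
  by apply: sumr_ge0 => k _; exact: sqr_ge0.
(* A vector whose coordinates are close to the sets Om i is close to Om. *)
have near_Om (v : 'rV[R]_N) (r : 'I_N -> R) (rho : R) : 0 <= rho ->
    \sum_i r i ^+ 2 <= rho ^+ 2 -> (forall i, 0 <= r i) ->
    (forall i l u, Om i l -> Om i u -> (forall q, Om i q -> l <= q <= u) ->
      l - r i <= v 0 i <= u + r i) -> enorm v <= rho + cx.
  move=> rho0 sr r0 vr.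
  pose q : 'rV[R]_N := \row_i proj_onto (Om i) (v 0 i).
  have Oq : action_set Om q by move=> i; rewrite mxE; exact: proj_onto_in.
  rewrite -(subrK q v); apply: (le_trans (enorm_triangle _ _)).
  apply: lerD; last exact: bx.
  apply: enorm_le => //; apply: le_trans sr; apply: ler_sum => i _.
  rewrite !mxE -ler_sqrt ?sqr_ge0// sqrtr_sqr sqrtr_sqr (ger0_norm (r0 i)).
  have [l [u [Ol Ou lu]]] := compact_bounds (Omk i) (Om0 i).
  have /andP[H1 H2] := vr i l u Ol Ou lu.
  exact: (proj_onto_dist (Omk i) (Om0 i) (Omc i) Ol Ou).
have xbound i l u s : (forall q, Om i q -> l <= q <= u) -> 0 <= s ->
    l - xi i <= x s 0 i <= u + xi i.
  move=> lu; have xi0 : 0 <= xi i by exact: normr_ge0.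
  have /andP[ls us] := lu _ (Oxs i).
  have : `|x 0 0 i - xs 0 i| <= xi i by [].
  rewrite ler_norml => /andP[x1 x2] s00; apply/andP; split.
    apply: (@relaxation_ge _ (fun s => x s 0 i) (fun s => p s 0 i) vsigma) => //.
    - by move=> r r0; exact: dx.
    - by move=> r r0; have /andP[] := lu _ (Op r r0 i); lra.
    - lra.
  apply: (@relaxation_le _ (fun s => x s 0 i) (fun s => p s 0 i) vsigma) => //.
  - by move=> r r0; exact: dx.
  - by move=> r r0; have /andP[] := lu _ (Op r r0 i); lra.
  - lra.
(* The estimates inherit the bounds of their leader, enlarged by eta j. *)
have ybound i j l u s : (forall q, Om j q -> l <= q <= u) -> 0 <= s ->
    l - (xi j + eta j) <= y s i j <= u + (xi j + eta j).
  move=> lu s00; have eta0 : 0 <= eta j by exact: sqrtr_ge0.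
  apply/andP; split.
    apply: (@consensus_ge _ _ a w (fun i s => y s i j) j) => //.
    - by move=> r k r0 kj; exact: dy.
    - by move=> r r0; rewrite yii//; have /andP[] := xbound j l u r lu r0; lra.
    - move=> k; have := eta_ge k j; rewrite ler_norml.
      by have /andP[] := xbound j l u 0 lu (lexx 0); lra.
  apply: (@consensus_le _ _ a w (fun i s => y s i j) j) => //.
  - by move=> r k r0 kj; exact: dy.
  - by move=> r r0; rewrite yii//; have /andP[] := xbound j l u r lu r0; lra.
  - move=> k; have := eta_ge k j; rewrite ler_norml.
    by have /andP[] := xbound j l u 0 lu (lexx 0); lra.
have eta_sum0 : 0 <= \sum_i eta i ^+ 2 by apply: sumr_ge0 => i _; exact: sqr_ge0.
have xi_sum0 : 0 <= \sum_i xi i ^+ 2 by apply: sumr_ge0 => i _; exact: sqr_ge0.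
split=> [|i].
  apply: (near_Om _ xi) => // [|i|i l u _ _ lu]; last exact: xbound.
    by rewrite z0 -sum_eta -sum_xi; lra.
  exact: normr_ge0.
apply: (near_Om _ (fun j => xi j + eta j)).
- by rewrite mulr_ge0.
- rewrite exprMn z0 -sum_xi -sum_eta.
  apply: (@le_trans _ _ (\sum_j (2 * xi j ^+ 2 + 2 * eta j ^+ 2))).
    by apply: ler_sum => j _; have := sqr_ge0 (xi j - eta j); nra.
  by rewrite big_split/= -!mulr_sumr; lra.
- by move=> j; rewrite addr_ge0// ?sqrtr_ge0 ?normr_ge0.
- by move=> j l u _ _ lu; rewrite mxE; exact: ybound.
Qed.

(** * Decay of the actions and of the consensus errors *)

(** The pinned Laplacian [L_i + B_i] is the form of the full consensus dynamics
    on vectors vanishing at the vertex [i]. *)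
Lemma consensus_coercive (R : realType) (N : nat) (a : 'M[R]_N) (l : R)
    (i : 'I_N) (v : 'I_N -> R) :
  (forall j k, a j k = a k j) -> smallest_eigenvalue a l -> v i = 0 ->
  l * \sum_j v j ^+ 2 <= \sum_j v j * \sum_k a j k * (v j - v k).
Proof.
move=> asym [_ minl] vi.
pose M := deleted_laplacian a i + leader_mx a i.
have symM : M^T = M.
  apply/matrixP => j k; rewrite !mxE asym.
  congr (_ - _ + _).
    by have [->|jk] := eqVneq j k; rewrite // eq_sym (negbTE jk).
  by have [->|jk] := eqVneq j k; rewrite // eq_sym (negbTE jk).
pose u : 'rV[R]_N.-1 := \row_j v (lift i j).
have := symmetric_eigenvalue_lower_bound symM (minl i) u.
rewrite -enorm_sqr enorm_sum.
rewrite innerE.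
rewrite (@bigD1_ord _ _ _ _ i)//= [in X in _ -> _ <= X](@bigD1_ord _ _ _ _ i)//=.
rewrite vi expr0n mul0r !add0r.
under eq_bigr do rewrite mxE.
move=> /le_trans; apply; rewrite le_eqVlt; apply/orP; left; apply/eqP.
apply: eq_bigr => j _; rewrite [u 0 j]mxE mulrC; congr (_ * _).
rewrite /M /deleted_laplacian /laplacian /leader_mx mulmxDr mulmxBr.
rewrite !mul_mx_diag !mxE.
rewrite [RHS](@bigD1_ord _ _ _ _ i)//= vi subr0.
under [in RHS]eq_bigr do rewrite mulrBr.
rewrite sumrB -mulr_suml addrC mulrC; congr (_ + (_ - _)).
  by rewrite mulrC; congr (_ * _); apply: eq_bigr => k _; rewrite !mxE.
by apply: eq_bigr => k _; rewrite !mxE asym mulrC.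
Qed.

(** One coordinate of the projection inequality at the solution [x - e], where
    [r] is the projected step, [A] the difference of the full maps at the action
    and at the solution, and [B] the error caused by the estimates.  Young's
    inequality absorbs the cross terms into nine tenths of [r ^+ 2]; the last
    tenth is kept for the coupling with the estimates.  The weights are chosen
    so that, summed over [N] coordinates, the terms in [e] and [X] cost at most
    [1 / 12 + 5 / 12 = 1 / 2] times [N * g ^+ 2 * h ^+ 2], the share that half
    of [u1] sets aside for the penalty. *)
Lemma projected_step_decay (R : realType) (e r P A B X Y g h : R) :
  0 < g -> 0 < h -> (r + g * (P + A + B)) * (e + r) <= 0 ->
  A ^+ 2 <= 5 / 4 * h ^+ 2 * X -> B ^+ 2 <= 5 / 4 * h ^+ 2 * Y ->
  e * r + 1 / 10 * r ^+ 2 <=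
    - g * (P * (e + r)) - g * (A * e) + 1 / 12 * (g ^+ 2 * h ^+ 2) * e ^+ 2
    + 5 / 12 * (g ^+ 2 * h ^+ 2) * X
    + (15 / 4 + 25 / 12 * (g ^+ 2 * h ^+ 2)) * Y.
Proof.
move=> g0 h0 pr AX BY.
have h20 : 0 < h ^+ 2 by rewrite exprn_gt0.
have g20 : 0 < g ^+ 2 by rewrite exprn_gt0.
have H1 : - (9 / 10) * r ^+ 2 - g * ((A + B) * r) <=
    5 / 18 * (g ^+ 2 * (A + B) ^+ 2).
  rewrite -subr_ge0 (_ : _ - _ = 5 / 18 * (9 / 5 * r + g * (A + B)) ^+ 2).
    by rewrite mulr_ge0// sqr_ge0.
  by field.
have H2 : (A + B) ^+ 2 <= 6 / 5 * A ^+ 2 + 6 * B ^+ 2.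
  rewrite -subr_ge0 (_ : _ - _ = 1 / 5 * (A - 5 * B) ^+ 2).
    by rewrite mulr_ge0// sqr_ge0.
  by field.
have H3 : - g * (B * e) <=
    1 / 12 * (g ^+ 2 * h ^+ 2) * e ^+ 2 + 3 * (B ^+ 2 / h ^+ 2).
  rewrite -subr_ge0 (_ : _ - _ = 1 / 12 * (g * h * e + 6 * (B / h)) ^+ 2).
    by rewrite mulr_ge0// sqr_ge0.
  by field; rewrite gt_eqF.
have H4 : B ^+ 2 / h ^+ 2 <= 5 / 4 * Y by rewrite ler_pdivrMr// mulrAC.
have H5 := ler_wpM2l (ltW g20) AX.
have H6 := ler_wpM2l (ltW g20) BY.
have H7 := ler_wpM2l (ltW g20) H2.
lra.
Qed.

(** Summing over the coordinates, the value [G0] of the map at the solution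
    drops out by its variational inequality, and monotonicity leaves the damping
    [g * d]. *)
Lemma action_decay (R : realType) (N : nat) (x xs p G0 Dl D Y : 'I_N -> R)
    (g d h : R) :
  (0 < N)%N -> 0 < g -> 0 < h ->
  (forall i, (x i - g * (G0 i + Dl i + D i) - p i) * (xs i - p i) <= 0) ->
  0 <= \sum_i G0 i * (p i - xs i) ->
  d * \sum_i (x i - xs i) ^+ 2 <= \sum_i Dl i * (x i - xs i) ->
  (forall i, Dl i ^+ 2 <= 5 / 4 * h ^+ 2 * \sum_i (x i - xs i) ^+ 2) ->
  (forall i, D i ^+ 2 <= 5 / 4 * h ^+ 2 * Y i) ->
  \sum_i (x i - xs i) * (p i - x i) + 1 / 10 * \sum_i (p i - x i) ^+ 2 <=
  (- g * d + 1 / 2 * g ^+ 2 * (N%:R * h ^+ 2)) * \sum_i (x i - xs i) ^+ 2 +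
  (15 / 4 + 25 / 12 * (g ^+ 2 * h ^+ 2)) * \sum_i Y i.
Proof.
move=> N0 g0 h0 proj vi mono DlX DY.
set X := \sum_i (x i - xs i) ^+ 2 in mono DlX *.
have X0 : 0 <= X by apply: sumr_ge0 => i _; exact: sqr_ge0.
have pw i : (x i - xs i) * (p i - x i) + 1 / 10 * (p i - x i) ^+ 2 <=
    - g * (G0 i * (p i - xs i)) - g * (Dl i * (x i - xs i))
    + 1 / 12 * (g ^+ 2 * h ^+ 2) * (x i - xs i) ^+ 2
    + 5 / 12 * (g ^+ 2 * h ^+ 2) * X
    + (15 / 4 + 25 / 12 * (g ^+ 2 * h ^+ 2)) * Y i.
  rewrite (_ : p i - xs i = x i - xs i + (p i - x i)); last ring.
  apply: projected_step_decay => //.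
  rewrite -[leLHS]opprK -mulrN -mulNr; have := proj i.
  by congr (_ <= _); ring.
have := ler_sum (index_enum 'I_N) (fun i (_ : true) => pw i).
rewrite !big_split/= sumrN -!mulr_sumr -/X sumr_const card_ord -mulr_natl => S.
have N1 : 1 <= N%:R :> R by rewrite ler1n.
have gh : 0 <= g ^+ 2 * h ^+ 2 * X.
  by apply: mulr_ge0 => //; apply: mulr_ge0; exact: sqr_ge0.
have H1 := mulr_ge0 (ltW g0) vi.
have H2 := ler_wpM2l (ltW g0) mono.
have H3 := ler_wpM2r gh N1.
lra.
Qed.

(** * Slopes and vanishing of a Lyapunov function *)

Lemma cvg_max_cst (R : realType) (c t : R) :
  Num.max s c @[s --> t] --> Num.max t c.
Proof.
apply/cvgrPdist_lt => e e0; near=> s.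
have : `|t - s| < e by near: s; exact: cvgr_dist_lt.
apply: le_lt_trans; rewrite /Num.max.
case: (ltP t c) => tc; case: (ltP s c) => sc; rewrite ler_norml;
  have := ler_norm (t - s); have := ler_norm (- (t - s)); rewrite ?normrN; lra.
Unshelve. all: by end_near. Qed.

Lemma cont0y_max_continuous (R : realType) (u : R -> R) :
  cont0y u -> continuous (fun s : R => u (Num.max s 0)).
Proof.
move=> cu t; apply: (@cvg_comp _ _ _ (fun s : R => Num.max s 0) u (nbhs t)
  (within [set s : R | 0 <= s] (nbhs (Num.max t 0)))); last first.
  by apply: cu; rewrite le_max lexx orbT.
move=> P /= HP.
have {}HP : nbhs (Num.max t 0) (fun s => 0 <= s -> P s) by [].
have cm : Num.max s 0 @[s --> t] --> Num.max t 0.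
  exact: cvg_max_cst.
have H : nbhs t (fun s => 0 <= Num.max s 0 -> P (Num.max s 0)) := cm _ HP.
suff : nbhs t (fun s => P (Num.max s 0)) by [].
by apply: filterS H => s; apply; rewrite le_max lexx orbT.
Qed.

(** The integrand is known to be continuous only on the half-line; extending it
    by its value at 0 changes no integral and makes it continuous everywhere. *)
Lemma int0_derivable (R : realType) (u : R -> R) (t : R) :
  cont0y u -> 0 < t -> derivable (int0 u) t 1 /\ derive1 (int0 u) t = u t.
Proof.
move=> cu t0; pose v (s : R) := u (Num.max s 0).
have cv : continuous v := cont0y_max_continuous cu.
have -> : int0 u = int0 v.
  apply/funext => s; apply: eq_Rintegral => r; rewrite inE/= in_itv/= => /andP[r0 _].
  by rewrite /v max_l.
have -> : u t = v t by rewrite /v max_l// ltW.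
apply: (@continuous_FTC1 _ v (BLeft 0) t (t + 1)) => //.
- by rewrite ltrDl.
- apply: continuous_compact_integrable; first exact: segment_compact.
  by apply: continuous_subspaceT => s; exact: cv.
- exact: cv.
Qed.

Lemma derivable_rderiv (R : realType) (phi : R -> R) (t : R) :
  derivable phi t 1 -> rderiv phi t (derive1 phi t).
Proof.
move=> dphi.
have H : h^-1 *: (phi (h *: 1 + t) - phi t) @[h --> (0 : R)^']
    --> derive1 phi t.
  by rewrite derive1E.
apply/cvgrPdist_le => e e0.
have [d /= d0 Hd] := (cvgrPdist_le _ _).1 H e e0.
exists d => //= s; rewrite /ball_/= => st ts.
have := Hd (s - t); rewrite /ball_/= sub0r normrN distrC => /(_ st).
rewrite subr_eq0 gt_eqF// => /(_ isT).
by rewrite /GRing.scale/= mulr1 subrK mulrC.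
Qed.

(** If [V] decays at a rate [u] of infinite mass up to a perturbation
    negligible with respect to [u], then above any positive level [V] has slope
    at most a negative multiple of [u]: it must reach the level, since
    [V + eta / 4 * int0 u] does not increase before, and cannot cross it
    again. *)
Lemma lyapunov_vanishing (R : realType) (V u r : R -> R) (K : R) :
  cont0y V -> cont0y u -> (forall t, 0 <= t -> 0 < u t) ->
  (forall t, 0 <= t -> 0 <= V t) -> 0 < K ->
  int0 u t @[t --> +oo] --> +oo ->
  r t / u t @[t --> +oo] --> 0 ->
  (\forall t \near +oo,
    rslope_le V t (- (1 / 2) * u t * V t + K * r t * (1 + V t))) ->
  V t @[t --> +oo] --> 0.
Proof.
move=> cV cu u0 V0 K0 Ioo ru slope.
suff H eta : 0 < eta -> \forall t \near +oo, V t <= eta.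
  apply/cvgrPdist_le => e e0.
  have tge : \forall t \near +oo, (0 : R) <= t by exact: nbhs_pinfty_ge.
  apply: filterS2 (H e e0) tge => t Vt t0.
  by rewrite sub0r normrN ger0_norm// V0.
move=> eta0; (* With r <= k * u, the perturbation is at most u * V / 4 where V > eta. *)
pose k := (4 * K * (eta^-1 + 1))^-1.
have ei0 : 0 < eta^-1 by rewrite invr_gt0.
have k0 : 0 < k by rewrite invr_gt0 !mulr_gt0//; lra.
have decay : \forall t \near +oo, eta < V t -> rslope_le V t (- (eta / 4 * u t)).
  have rk : \forall t \near +oo, r t / u t <= k by exact: (cvgr_le 0).
  have tge : \forall t \near +oo, (0 : R) <= t by exact: nbhs_pinfty_ge.
  apply: filterS3 tge slope rk => t t0 sl; rewrite ler_pdivrMr ?u0// => rk Vt.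
  apply: rslope_leW sl _.
  have ut := u0 t t0.
  have H1 : 1 + V t <= (eta^-1 + 1) * V t.
    rewrite mulrDl mul1r lerD2r mulrC -[leLHS](mulfV (lt0r_neq0 eta0)).
    by rewrite ler_pM2r// ltW.
  have H2 : K * r t * (1 + V t) <= K * (k * u t) * ((eta^-1 + 1) * V t).
    have V1 : 0 <= 1 + V t by have := V0 t t0; lra.
    apply: (@le_trans _ _ (K * (k * u t) * (1 + V t))).
      by rewrite ler_wpM2r// ler_pM2l.
    by rewrite ler_wpM2l// !mulr_ge0// ltW.
  have H3 : K * (k * u t) * ((eta^-1 + 1) * V t) = u t * V t / 4.
    rewrite /k; field; rewrite !gt_eqF//=; lra.
  have H4 : u t * eta <= u t * V t by rewrite ler_pM2l// ltW.
  lra.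
have [M [_ decayM]] := decay.
pose T1 : R := Num.max (M + 1) 1.
have T1M : M < T1 by rewrite /T1 lt_max ltrDl ltr01.
have T10 : 0 < T1 by rewrite /T1 lt_max ltr01 orbT.
have [t1 Tt1 Vt1] : exists2 t1, T1 <= t1 & V t1 <= eta.
  apply: contrapT => /forall2NP above.
  have Vab (t : R) : T1 <= t -> eta < V t.
    by move=> Tt; have [//|] := above t; move/negP; rewrite ltNge.
  (* J agrees with the integral after T1 and is constant before. *)
  pose J (s : R) := int0 u (Num.max s T1).
  have cJ : cont0y J.
    move=> t t0; apply: (@cvg_comp _ _ _ (fun s : R => Num.max s T1) (int0 u) _
      (nbhs (Num.max t T1))).
      by apply: cvg_trans (@cvg_max_cst _ T1 t); apply: cvg_app; exact: cvg_within.
    have mT0 : 0 < Num.max t T1.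
      by apply: lt_le_trans T10 _; rewrite le_max lexx orbT.
    suff : {for Num.max t T1, continuous (int0 u)} by [].
    apply: differentiable_continuous; apply/derivable1_diffP.
    exact: (int0_derivable cu mT0).1.
  pose W s := V s + eta / 4 * J s.
  have cW : cont0y W.
    by apply: cont0yD => //; apply: cont0yM => //; exact: cont0y_cst.
  have WT t : T1 <= t -> W t <= W T1.
    apply: (barrier (ltW T10) cW) => // s Ts _.
    rewrite -(addNr (eta / 4 * u s)); apply: rslope_leD.
      by apply: decayM; [exact: lt_le_trans Ts|exact: Vab].
    apply: (@rderiv_slope_le _ _ _ (eta / 4 * u s)) => //; apply: rderivZ.
    have s0 : 0 < s by exact: lt_le_trans Ts.
    have [dI <-] := int0_derivable cu s0.
    apply: cvg_trans (derivable_rderiv dI).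
    apply: near_eq_cvg; near=> r0; rewrite /J !max_l//.
    by apply: (le_trans Ts); near: r0; exact: nbhs_right_ge.
  have Ibig : \forall t \near +oo, W T1 / (eta / 4) < int0 u t by exact: cvgry_gt.
  have tgeT : \forall t \near +oo, T1 <= t by apply: nbhs_pinfty_ge; exact: num_real.
  have big : \forall t \near +oo, W T1 / (eta / 4) < int0 u t /\ T1 <= t.
    exact: filterI Ibig tgeT.
  have [t [It Tt]] := filter_ex big.
  have := WT t Tt; have -> : W t = V t + eta / 4 * int0 u t by rewrite /W /J max_l.
  move: It; rewrite ltr_pdivrMr ?divr_gt0//.
  have t0 : 0 <= t by lra.
  by have := V0 t t0; lra.
near=> t; apply: (barrier (T := t1)) => //; first lra.
  move=> s t1s Vs; apply: (rslope_leW (decayM _ _ Vs)); first lra.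
  rewrite oppr_le0 mulr_ge0 ?divr_ge0 ?(ltW eta0)// ltW// u0//; lra.
Unshelve. all: by end_near. Qed.

(** * The Lyapunov function of the dynamics *)

Definition lyap (R : realType) (N : nat) (x : 'rV[R]_N) (y : 'M[R]_N)
    (xs : 'rV[R]_N) : R :=
  enorm (x - xs) ^+ 2 + \sum_i \sum_j (y j i - x 0 i) ^+ 2.

(** The moving target [xt] need not be differentiable.  Its Lipschitz bound
    [rho] yields a right-differentiable function that majorises the increments
    of the squared distance to it, which is enough for an upper slope. *)
Lemma lyap_slope (R : realType) (N : nat) (x xt : R -> 'rV[R]_N)
    (y : R -> 'M[R]_N) (rho : R -> R) (t k : R) (v : 'I_N -> R)
    (q : 'I_N -> 'I_N -> R) :
  0 <= t -> rho t = 0 -> (forall s, 0 <= s -> enorm (xt s - xt t) <= rho s) ->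
  rderiv rho t k -> (forall i, rderiv (fun s => x s 0 i) t (v i)) ->
  (forall i j, j != i -> rderiv (fun s => y s j i) t (q j i)) ->
  (forall s i, 0 <= s -> y s i i = x s 0 i) ->
  rslope_le (fun s => lyap (x s) (y s) (xt s)) t
    (2 * (\sum_i (x t 0 i - xt t 0 i) * v i
       + \sum_i \sum_j (y t j i - x t 0 i) * (q j i - v i))
     + 2 * enorm (x t - xt t) * k).
Proof.
move=> t0 rho0 lip drho dx dy yii.
pose X := enorm (x t - xt t).
pose e i := x t 0 i - xt t 0 i.
(* The term j = i vanishes identically but y s i i has no given derivative. *)
pose sq i j s := if j == i then 0 else (y s j i - x s 0 i) ^+ 2.
pose U s := \sum_i (2 * e i * (x s 0 i - x t 0 i) + 2 * (x s 0 i - x t 0 i) ^+ 2)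
  + (2 * X * rho s + 2 * rho s ^+ 2) + \sum_i \sum_j sq i j s.
have sqE s : 0 <= s -> \sum_i \sum_j (y s j i - x s 0 i) ^+ 2 = \sum_i \sum_j sq i j s.
  move=> s0; apply: eq_bigr => i _; apply: eq_bigr => j _; rewrite /sq.
  by have [->|//] := eqVneq j i; rewrite yii// subrr expr0n.
apply: (@rslope_le_majorant _ _ U).
- exact: t0.
- move=> s s0; rewrite /lyap !sqE// /U rho0 expr0n/= !mulr0 addr0.
  have -> : \sum_i (2 * e i * (x t 0 i - x t 0 i) + 2 * (x t 0 i - x t 0 i) ^+ 2) = 0.
    by rewrite big1// => i _; rewrite subrr expr0n/= !mulr0 addr0.
  have r0 : 0 <= rho s := le_trans (enorm_ge0 _) (lip s s0).
  have X0 : 0 <= X by exact: enorm_ge0.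
  pose a := x s - x t; pose d := xt s - xt t.
  have -> : \sum_i (2 * e i * (x s 0 i - x t 0 i) + 2 * (x s 0 i - x t 0 i) ^+ 2)
      = 2 * inner (x t - xt t) a + 2 * inner a a.
    rewrite !innerE !mulr_sumr -big_split/=.
    by apply: eq_bigr => i _; rewrite /e /a !mxE; ring.
  have -> : x s - xt s = (x t - xt t) + (a - d).
    by rewrite /a /d; apply/rowP => i; rewrite !mxE; ring.
  have H1 : - inner (x t - xt t) d <= X * rho s.
    rewrite -innerNr; apply: (le_trans (inner_le_enorm _ _)).
    by rewrite enormN ler_wpM2l// lip.
  have H2 : inner d d <= rho s ^+ 2.
    by rewrite -enorm_sqr ler_pXn2r// ?nnegrE ?enorm_ge0// lip.
  have H3 := inner_ge0 (a + d).
  rewrite !enorm_sqr; clearbody a d.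
  move: (x t - xt t) H1 => z H1.
  move: H3; rewrite !innerDl !innerDr !innerNl !innerNr.
  rewrite (innerC a z) (innerC d z) (innerC d a).
  lra.
- rewrite /U; apply: rderivD; last first.
    apply: rderiv_sum => i; apply: rderiv_sum => j; rewrite /sq.
    apply: (_ : rderiv _ t
      (if j == i then 0 else 2 * (y t j i - x t 0 i) * (q j i - v i))).
    have [ji|ji] := eqVneq j i; first exact: rderiv_cst.
    by apply: rderiv_sqr; apply: rderivB; [exact: dy|exact: dx].
  apply: rderivD; last first.
    by apply: rderivD; apply: rderivZ; [exact: drho|exact: rderiv_sqr drho].
  apply: rderiv_sum => i.
  have dxi : rderiv (fun s => x s 0 i - x t 0 i) t (v i).
    by rewrite -[v i]subr0; apply: rderivB; [exact: dx|exact: rderiv_cst].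
  by apply: rderivD; apply: rderivZ; [exact: dxi|exact: rderiv_sqr dxi].
- rewrite rho0 mulr0 mul0r mulr0 addr0 mulrDr addrAC le_eqVlt.
  apply/predU1P; left; congr (_ + _ + _); rewrite mulr_sumr; apply: eq_bigr => i _.
    by rewrite subrr mulr0 mul0r mulr0 addr0 mulrA.
  rewrite mulr_sumr; apply: eq_bigr => j _.
  have [->|_] := eqVneq j i; last by rewrite mulrA.
  by rewrite yii// subrr mul0r mulr0.
Qed.

(** The velocity [s * r i] of the leader [i] perturbs each of its [N] estimates;
    Young's inequality with weight [N] charges a tenth of [r i ^+ 2] in total. *)
Lemma consensus_decay (R : realType) (N : nat) (a : 'M[R]_N) (l w s : R)
    (x : 'rV[R]_N) (y : 'M[R]_N) (r : 'I_N -> R) :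
  (0 < N)%N -> (forall j k, a j k = a k j) -> smallest_eigenvalue a l ->
  0 <= w -> 0 <= s -> (forall i, y i i = x 0 i) ->
  \sum_i \sum_j (y j i - x 0 i) *
    (- w * (\sum_k a j k * (y j i - y k i)) - s * r i) <=
  (5 / 2 * N%:R * s - w * l) * (\sum_i \sum_j (y j i - x 0 i) ^+ 2)
  + s * (1 / 10 * \sum_i r i ^+ 2).
Proof.
move=> N0 asym lP w0 s0 yii.
have NR0 : 0 < N%:R :> R by rewrite ltr0n.
rewrite !mulr_sumr -big_split/=; apply: ler_sum => i _.
pose v j := y j i - x 0 i.
have vi : v i = 0 by rewrite /v yii subrr.
have H1 := ler_wpM2l w0 (consensus_coercive asym lP vi).
have H2 : - \sum_j v j * r i <=
    5 / 2 * N%:R * \sum_j v j ^+ 2 + 1 / 10 * r i ^+ 2.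
  apply: (@le_trans _ _
    (\sum_j (5 / 2 * N%:R * v j ^+ 2 + N%:R^-1 * (1 / 10 * r i ^+ 2)))).
    rewrite -sumrN; apply: ler_sum => j _.
    rewrite -subr_ge0 (_ : _ - _ = 5 / 2 * N%:R^-1 * (N%:R * v j + 1 / 5 * r i) ^+ 2).
      by rewrite mulr_ge0 ?sqr_ge0// mulr_ge0// invr_ge0 ltW.
    by field; rewrite gt_eqF.
  rewrite big_split/= mulr_sumr lerD2l sumr_const card_ord -[leLHS]mulr_natl.
  by rewrite mulVKf ?gt_eqF.
have -> : \sum_j v j * (- w * (\sum_k a j k * (y j i - y k i)) - s * r i) =
    - (w * \sum_j v j * \sum_k a j k * (v j - v k)) + s * (- \sum_j v j * r i).
  rewrite mulrN !mulr_sumr -!sumrN -big_split/=; apply: eq_bigr => j _.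
  rewrite (_ : \sum_k a j k * (y j i - y k i) = \sum_k a j k * (v j - v k)); first ring.
  by apply: eq_bigr => k _; rewrite /v opprB addrA subrK.
have H3 := ler_wpM2l s0 H2.
move: H1 H3; rewrite -/(v _); set S := \sum_j v j ^+ 2.
lra.
Qed.

(** Adding the decay of the actions to that of the estimates, the terms in
    [(p - x) ^+ 2 / 10] cancel and the consensus gain [w * l] pays for the
    estimation errors.  The maps [F] and [P] stand for the partial derivatives
    of the costs and of the penalty, whose Lipschitz constants are [b1] towards
    the solution, [b3] towards the estimates, and [b2].  Once the penalty weight
    [b2 * e] is ten times larger than [b1 + d] and [b3], each of the total
    constants [b1 + b2 * e + d] and [b3 + b2 * e] is at most
    [11 / 10 * (b2 * e)], whose square is below [5 / 4 * (b2 * e) ^+ 2]. *)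
Lemma lyap_dissipation (R : realType) (N : nat) (a : 'M[R]_N)
    (F P : 'I_N -> 'rV[R]_N -> R)
    (d e g s w l b1 b2 b3 u U : R) (x xs p : 'rV[R]_N) (y : 'M[R]_N) :
  let Phi v i := F i v + d * v 0 i + e * P i v in
  (0 < N)%N -> (forall j k, a j k = a k j) -> smallest_eigenvalue a l ->
  d * enorm (x - xs) ^+ 2 <= \sum_i (Phi x i - Phi xs i) * (x 0 i - xs 0 i) ->
  0 <= \sum_i Phi xs i * (p 0 i - xs 0 i) ->
  (forall i, (x 0 i - g * (F i (row i y) + e * P i (row i y) + d * x 0 i)
     - p 0 i) * (xs 0 i - p 0 i) <= 0) ->
  (forall i, y i i = x 0 i) ->
  (forall i, `|F i x - F i xs| <= b1 * enorm (x - xs)) ->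
  (forall i, `|F i x - F i (row i y)| <= b3 * enorm (x - row i y)) ->
  (forall i v v', `|P i v - P i v'| <= b2 * enorm (v - v')) ->
  0 < d -> 0 < e -> 0 < g -> 0 < s -> 0 < w ->
  0 < b2 ->
  10 * (b1 + d) <= b2 * e -> 10 * b3 <= b2 * e ->
  15 + 10 * N%:R <= (b2 * e) ^+ 2 -> g <= 1 / 5 ->
  0 < u -> u <= 2 * (g * d) - g ^+ 2 * (N%:R * (b2 * e) ^+ 2) ->
  (b2 * e) ^+ 2 <= U -> 1 / 4 * u * s + U * s / 2 <= w * l ->
  \sum_i (x 0 i - xs 0 i) * (s * (p 0 i - x 0 i))
  + \sum_i \sum_j (y j i - x 0 i) *
      (- w * (\sum_k a j k * (y j i - y k i)) - s * (p 0 i - x 0 i))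
  <= - (1 / 4 * u * s) * lyap x y xs.
Proof.
move=> Phi N0 asym lP mono VIxs proj yii Lb1 Lb3 Lb2.
move=> d0 e0 g0 s0 w0 b20 h1 h3 hN g5 u0 uP UP wP.
set h := b2 * e in h1 h3 hN uP UP *.
have h0 : 0 < h by rewrite mulr_gt0.
pose D i := F i (row i y) - F i x + e * (P i (row i y) - P i x).
have sqb (z B : R) : `|z| <= B -> z ^+ 2 <= B ^+ 2.
  move=> zB; rewrite -(real_normK (num_real z)) ler_pXn2r// nnegrE.
  exact: le_trans zB.
have XE : \sum_i (x 0 i - xs 0 i) ^+ 2 = enorm (x - xs) ^+ 2.
  by rewrite enorm_sum; apply: eq_bigr => i _; rewrite !mxE.
have X0 := enorm_ge0 (x - xs).
have YE : \sum_i enorm (x - row i y) ^+ 2 = \sum_i \sum_j (y j i - x 0 i) ^+ 2.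
  rewrite exchange_big/=; apply: eq_bigr => i _; rewrite enorm_sum.
  by apply: eq_bigr => j _; rewrite !mxE -sqrrN opprB.
have decay : \sum_i (x 0 i - xs 0 i) * (p 0 i - x 0 i)
    + 1 / 10 * \sum_i (p 0 i - x 0 i) ^+ 2 <=
  (- g * d + 1 / 2 * g ^+ 2 * (N%:R * h ^+ 2)) * enorm (x - xs) ^+ 2 +
  (15 / 4 + 25 / 12 * (g ^+ 2 * h ^+ 2)) * \sum_i \sum_j (y j i - x 0 i) ^+ 2.
  rewrite -XE -YE.
  apply: (action_decay (G0 := Phi xs) (Dl := fun i => Phi x i - Phi xs i)
    (D := D)) => //; rewrite ?XE//.
  - move=> i; have := proj i; congr (_ * _ <= 0); congr (_ - _ * _ - _).
    by rewrite /D /Phi; ring.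
  - move=> i; have : `|Phi x i - Phi xs i| <= 11 / 10 * h * enorm (x - xs).
      rewrite (_ : _ - _ = (F i x - F i xs)
        + (d * (x 0 i - xs 0 i) + e * (P i x - P i xs))); last by rewrite /Phi; ring.
      apply: le_trans (ler_normD _ _) _.
      apply: (@le_trans _ _ (b1 * enorm (x - xs)
        + (d * enorm (x - xs) + e * (b2 * enorm (x - xs))))).
        apply: lerD; first exact: Lb1.
        apply: le_trans (ler_normD _ _) _.
        rewrite !normrM (gtr0_norm d0) (gtr0_norm e0).
        apply: lerD; last by apply: ler_wpM2l; [exact: ltW|exact: Lb2].
        apply: ler_wpM2l; first exact: ltW.
        by have := coord_le_enorm (x - xs) i; rewrite !mxE.
      have : 10 * (b1 + d) * enorm (x - xs) <= h * enorm (x - xs).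
        by rewrite ler_wpM2r.
      rewrite /h; lra.
    move=> /sqb/le_trans; apply.
    have := mulr_ge0 (sqr_ge0 h) (sqr_ge0 (enorm (x - xs))).
    by rewrite !exprMn; lra.
  - move=> i; have : `|D i| <= 11 / 10 * h * enorm (x - row i y).
      rewrite /D; apply: le_trans (ler_normD _ _) _.
      rewrite normrM (gtr0_norm e0) (distrC (F i _)) (distrC (P i _)).
      have := Lb3 i; have := ler_wpM2l (ltW e0) (Lb2 i x (row i y)).
      have : 10 * b3 * enorm (x - row i y) <= h * enorm (x - row i y).
        by rewrite ler_wpM2r// enorm_ge0.
      rewrite /h; lra.
    move=> /sqb/le_trans; apply.
    have := mulr_ge0 (sqr_ge0 h) (sqr_ge0 (enorm (x - row i y))).
    by rewrite !exprMn; lra.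
have consensus := @consensus_decay R N a l w s x y (fun i => p 0 i - x 0 i)
  N0 asym lP (ltW w0) (ltW s0) yii.
have Y20 : 0 <= \sum_i \sum_j (y j i - x 0 i) ^+ 2.
  by apply: sumr_ge0 => i _; apply: sumr_ge0 => j _; exact: sqr_ge0.
have g2 : g ^+ 2 <= 1 / 25 by rewrite expr2; nra.
rewrite (_ : \sum_i (x 0 i - xs 0 i) * (s * (p 0 i - x 0 i)) =
  s * \sum_i (x 0 i - xs 0 i) * (p 0 i - x 0 i)); last first.
  by rewrite mulr_sumr; apply: eq_bigr => i _; rewrite mulrCA.
have Xcoef : - g * d + 1 / 2 * g ^+ 2 * (N%:R * h ^+ 2) <= - (1 / 4 * u) by lra.
have {}Xcoef := ler_wpM2r (sqr_ge0 (enorm (x - xs))) Xcoef.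
have {Xcoef}decay := le_trans decay (lerD Xcoef (lexx _)).
have {}decay := ler_wpM2l (ltW s0) decay.
have Ycoef : 15 / 4 + 25 / 12 * (g ^+ 2 * h ^+ 2) + 5 / 2 * N%:R <= U / 2.
  have : g ^+ 2 * h ^+ 2 <= 1 / 25 * h ^+ 2 by rewrite ler_wpM2r// sqr_ge0.
  by have := sqr_ge0 h; lra.
have {}Ycoef := ler_wpM2r Y20 (ler_wpM2l (ltW s0) Ycoef).
have wlP := ler_wpM2r Y20 wP.
rewrite /lyap; lra.
Qed.

(** * Convergence to the least-norm equilibrium *)

Lemma step_le_of_u1_gt0 (R : realType) (g d K1 : R) :
  0 < g -> 1 <= K1 -> 0 < - g ^+ 2 * K1 + 2 * g * d -> g <= 2 * d.
Proof.
move=> g0 K1ge; rewrite (_ : _ + _ = g * (2 * d - g * K1)); last ring.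
rewrite pmulr_rgt0// subr_gt0 => H.
have : g * 1 <= g * K1 by rewrite ler_pM2l.
lra.
Qed.

(** The two subtracted quotients in [theta] are nonnegative. *)
Lemma theta_lower (R : realType) (N : nat) (l s w u U : R) :
  0 < u < 1 -> 0 <= s -> 0 <= U ->
  1 / 4 * u * s <= w * l - U * s / 2 - s * (2 - u) * (N%:R - 1) ^+ 2 / u
    - u * U * s / (4 * (2 - u)) ->
  1 / 4 * u * s + U * s / 2 <= w * l.
Proof.
move=> /andP[u0 u1] s0 U0.
have H1 : 0 <= s * (2 - u) * (N%:R - 1) ^+ 2 / u.
  apply: divr_ge0; last exact: ltW.
  by apply: mulr_ge0; [apply: mulr_ge0 => //; lra|exact: sqr_ge0].
have H2 : 0 <= u * U * s / (4 * (2 - u)).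
  apply: divr_ge0; last lra.
  by apply: mulr_ge0 => //; apply: mulr_ge0 => //; exact: ltW.
lra.
Qed.

Theorem theorem2 (R : realType) (N n : nat)
  (f : 'I_N -> 'rV[R]_N -> R) (Om : 'I_N -> set R)
  (A : 'M[R]_(n, N)) (b : 'cV[R]_n)
  (E : rel 'I_N) (a : 'M[R]_N)
  (delta eps vsigma gam w : R -> R)
  (xstar : 'rV[R]_N) (xt : R -> 'rV[R]_N)
  (cx cp c0 c b1 b2 b3 lmin : R)
  (x : R -> 'rV[R]_N) (y : R -> 'M[R]_N)
  (* the game *)
  (f_C2 : forall i, contDiff 2 (f i))
  (f_convex : forall i (v : 'rV[R]_N),
    convex_function [set: R^o] (fun s : R^o => f i (set_coord v i s)))
  (F_monotone : monotone_map (pseudo_gradient f))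
  (Om_nonempty : forall i, Om i !=set0)
  (Om_convex : forall i, convex_set (Om i : set R^o))
  (Om_compact : forall i, compact (Om i))
  (Q_slater : slater Om A b)
  (xstarP : least_norm_in (variational_equilibrium f Om A b) xstar)
  (* the communication graph *)
  (E_connected : undirected_connected E)
  (a_adjacency : adjacency_of E a)
  (lminP : smallest_eigenvalue a lmin)
  (* the parameters *)
  (deltaP : smooth_positive delta)
  (epsP : smooth_positive eps)
  (vsigmaP : smooth_positive vsigma)
  (gamP : smooth_positive gam)
  (wP : smooth_positive w)
  (xtP : forall t : R, 0 <= t ->
    VI (action_set Om) (Phi_de f A b (delta t) (eps t)) (xt t))
  (* the dynamics *)
  (xyP : is_trajectory f Om A b a delta eps vsigma gam w x y)
  (* the constants *)
  (cx_gt0 : 0 < cx) (cp_gt0 : 0 < cp) (c0_gt0 : 0 < c0) (c_gt0 : 0 < c)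
  (b1_gt0 : 0 < b1) (b2_gt0 : 0 < b2) (b3_gt0 : 0 < b3)
  (cxP : forall v, action_set Om v -> enorm v <= cx)
  (cpP : forall v, action_set Om v -> enorm (grad (penalty A b) v) <= cp)
  (cP : Num.max cx cp * c0 <= c)
  (b1P : forall i (t : R) v, 0 <= t ->
    enorm v <= enorm (zvec (x 0) (y 0) (xt 0)) + c + cx ->
    `|partial i (f i) v - partial i (f i) (xt t)| <= b1 * enorm (v - xt t))
  (b2P : forall i v v',
    `|partial i (penalty A b) v - partial i (penalty A b) v'|
      <= b2 * enorm (v - v'))
  (b3P : forall i v v',
    enorm v <= enorm (zvec (x 0) (y 0) (xt 0)) + c + cx ->
    enorm v' <= 2 * (enorm (zvec (x 0) (y 0) (xt 0)) + c) + cx ->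
    `|partial i (f i) v - partial i (f i) v'| <= b3 * enorm (v - v')) :
  let u1 := u1 N b1 b2 delta eps gam in
  let u2 := u2 b2 b3 eps gam in
  let r2 := r2 delta eps in
  let J := int0 (fun s => r2 s * expR (E_int u1 vsigma s)) in
  (* (i) *)
  (forall t : R, 0 <= t -> 0 < u1 t < 1) ->
  r2 t / (u1 t * vsigma t) @[t --> +oo] --> 0 ->
  int0 (fun s => u1 s * vsigma s) t @[t --> +oo] --> +oo ->
  ((exists M : R, forall t : R, 0 <= t -> `|J t| <= M) \/ J t @[t --> +oo] --> +oo) ->
  (* (ii) *)
  (forall t : R, 0 <= t -> J t / expR (E_int u1 vsigma t) <= c0) ->
  (* (iii) *)
  delta t @[t --> +oo] --> 0 ->
  delta t ^+ 2 * eps t @[t --> +oo] --> +oo ->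
  eps t @[t --> +oo] --> +oo ->
  (* (iv) *)
  (forall t : R, 0 <= t ->
    theta N lmin u1 u2 vsigma w t >= 1 / 4 * u1 t * vsigma t) ->
  x t @[t --> +oo] --> xstar.
Proof.
move=> U1 U2 R2 J u1P r2u1 intu1 _ _ d0 d2e eoo thetaP.
have N0 : (0 < N)%N by case: lminP => [[i _] _]; exact: leq_ltn_trans (ltn_ord i).
have [asym apos anull _] := a_adjacency.
have a0 i k : 0 <= a i k.
  have [Eki|nEki] := boolP (E k i); first by rewrite ltW// apos.
  by rewrite anull.
have dpos t : 0 <= t -> 0 < delta t by case: deltaP => _; apply.
have epos t : 0 <= t -> 0 < eps t by case: epsP => _; apply.
have spos t : 0 <= t -> 0 < vsigma t by case: vsigmaP => _; apply.
have gpos t : 0 <= t -> 0 < gam t by case: gamP => _; apply.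
have wpos t : 0 <= t -> 0 < w t by case: wP => _; apply.
have ddelta t : 0 <= t -> derivable0y delta t.
  by case: deltaP => /(_ 0%N) H _ t0; exact: H.
have deps t : 0 <= t -> derivable0y eps t.
  by case: epsP => /(_ 0%N) H _ t0; exact: H.
have cdelta : cont0y delta by exact: derivable0y_cont.
have ceps : cont0y eps by exact: derivable0y_cont.
have cvs : cont0y vsigma.
  by apply: derivable0y_cont => t t0; case: vsigmaP => /(_ 0%N) H _; exact: H.
have cgam : cont0y gam.
  by apply: derivable0y_cont => t t0; case: gamP => /(_ 0%N) H _; exact: H.
have cF i : continuous (partial i (f i)).
  by have /= [_ /(_ i)[_ []]] := f_C2 i.
have cx_ge0 : 0 <= cx by exact: ltW.
pose cpx := Num.max cx cp.
have cpx0 : 0 < cpx by rewrite lt_max cx_gt0.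
pose p t : 'rV[R]_N := \row_i proj_onto (Om i)
  (x t 0 i - gam t * (partial i (f i) (row i (y t))
     + eps t * partial i (penalty A b) (row i (y t)) + delta t * x t 0 i)).
have Op t : action_set Om (p t) by move=> i; rewrite mxE; exact: proj_onto_in.
have yii t : 0 <= t -> forall i, y t i i = x t 0 i by move=> /xyP[].
have dx t i : 0 <= t -> rderiv (fun s => x s 0 i) t (vsigma t * (p t 0 i - x t 0 i)).
  move=> t0; apply: is_derive0y_rderiv => //; rewrite mxE.
  by have [_ /(_ i)] := xyP t t0.
have dy t i j : 0 <= t -> i != j ->
    rderiv (fun s => y s i j) t (- w t * \sum_k a i k * (y t i j - y t k j)).
  move=> t0 ij; apply: is_derive0y_rderiv => //.
  by have [_ _] := xyP t t0; apply; rewrite eq_sym.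
have contx i : cont0y (fun s => x s 0 i).
  by apply: derivable0y_cont => t t0; have [_ /(_ i)[]] := xyP t t0.
have conty i j : cont0y (fun s => y s i j).
  have [<-|ij] := eqVneq i j; last first.
    by apply: derivable0y_cont => t t0; have [_ _ /(_ i j)] := xyP t t0;
       rewrite eq_sym => /(_ ij)[].
  move=> t t0; rewrite yii//; apply: cvg_trans (contx i t t0).
  apply: near_eq_cvg; near=> s; rewrite yii//.
  by near: s; exact: withinT.
set z0 := enorm _ in b1P b3P.
have Oxt0 : action_set Om (xt 0) by have [] := xtP 0 (lexx 0).
(* The trajectory stays in the balls on which b1 and b3 are Lipschitz constants. *)
have bounds := trajectory_bounds Om_convex Om_compact cxP Oxt0 a0 spos wpos
  contx conty (fun t _ => Op t) dx dy yii.
have z0_ge0 : 0 <= z0 by exact: enorm_ge0.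
have lip s t : 0 <= s -> 0 <= t -> enorm (xt s - xt t) <=
    cpx * (`|delta s - delta t| + `|eps s - eps t|) / delta t.
  move=> s0 t0; have [Os _] := xtP s s0.
  rewrite -opprB enormN ler_pdivlMr ?dpos// mulrC.
  apply: (VI_Phi_de_lipschitz F_monotone (ltW (epos t t0)) (xtP t t0) (xtP s s0)).
    exact: cxP.
  exact: cpP.
(* rho t s bounds the displacement of the target; its slope is cpx * r2. *)
pose rho t s := cpx * (`|delta s - delta t| + `|eps s - eps t|) / delta t.
have rhott t : rho t t = 0 by rewrite /rho !subrr normr0 addr0 mulr0 mul0r.
have drho t : 0 <= t -> rderiv (rho t) t (cpx * R2 t).
  move=> t0; rewrite /R2 /r2 mulrA [_ / _]mulrC.
  have -> : rho t = fun s => (delta t)^-1 *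
      (cpx * (`|delta s - delta t| + `|eps s - eps t|)).
    by apply/funext => s; rewrite /rho mulrC.
  apply: rderivZ; apply: rderivZ; apply: rderivD; apply: rderiv_dist.
    by apply: derivable0y_rderiv => //; exact: ddelta.
  by apply: derivable0y_rderiv => //; exact: deps.
have contxt i : cont0y (fun s => xt s 0 i).
  move=> t t0; apply/cvgrPdist_le => e e0.
  have crho : cont0y (rho t).
    apply: cont0yM; last exact: cont0y_cst.
    apply: cont0yM; first exact: cont0y_cst.
    apply: cont0yD => s s0; apply: cvg_norm; apply: cvgB; first exact: cdelta.
    - exact: cvg_cst.
    - exact: ceps.
    - exact: cvg_cst.
  have := crho t t0; rewrite rhott => /cvgrPdist_le/(_ e e0) H.
  have nonneg : \forall s \near within [set s : R | 0 <= s] (nbhs t), 0 <= s.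
    exact: withinT.
  apply: filterS2 H nonneg => s; rewrite sub0r normrN => rs s0.
  apply: le_trans (le_trans (ler_norm _) rs).
  apply: le_trans (lip s t s0 t0); rewrite distrC.
  by have := coord_le_enorm (xt s - xt t) i; rewrite !mxE.
pose V t := lyap (x t) (y t) (xt t).
have V0 t : 0 <= V t.
  rewrite /V /lyap addr_ge0 ?sqr_ge0//; apply: sumr_ge0 => i _.
  by apply: sumr_ge0 => j _; exact: sqr_ge0.
have cV : cont0y V.
  apply: cont0yD.
    have -> : (fun s => enorm (x s - xt s) ^+ 2) =
        fun s => \sum_i (x s 0 i - xt s 0 i) ^+ 2.
      by apply/funext => s; rewrite enorm_sum; apply: eq_bigr => i _; rewrite !mxE.
    by apply: cont0y_sum => i; apply: cont0y_sqr; exact: cont0yB.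
  apply: cont0y_sum => i; apply: cont0y_sum => j; apply: cont0y_sqr.
  exact: cont0yB.
pose u t := U1 t * vsigma t.
have u_gt0 t : 0 <= t -> 0 < u t.
  by move=> t0; rewrite mulr_gt0 ?spos//; have /andP[] := u1P t t0.
have cu : cont0y u.
  apply: cont0yM => //; rewrite /U1 /u1; apply: cont0yD.
    apply: cont0yM; first by apply: cont0yN; exact: cont0y_sqr.
    apply: cont0yD; last exact: cont0y_cst.
    apply: cont0yD; last exact: cont0y_sqr.
    apply: cont0yD; first exact: cont0y_cst.
    by apply: cont0yM; [exact: cont0y_cst|exact: cont0y_sqr].
  apply: cont0yM => //; apply: cont0yM => //; exact: cont0y_cst.
have tge : \forall t \near +oo, (0 : R) <= t by exact: nbhs_pinfty_ge.
have slope : \forall t \near +oo,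
    rslope_le V t (- (1 / 2) * u t * V t + cpx * R2 t * (1 + V t)).
  (* The bound on delta makes gam at most 1 / 5; H collects the lower bounds
     on b2 * eps that the dissipation estimate requires. *)
  have dsmall : \forall t \near +oo, delta t <= 1 / 10.
    by apply: (cvgr_le 0) => //; lra.
  pose H := Num.max (10 * (b1 + 1)) (Num.max (10 * b3) (15 + 10 * N%:R)).
  have hbig : \forall t \near +oo, H / b2 <= eps t by exact: cvgry_ge.
  apply: filterS3 tge dsmall hbig => t t0 dt et.
  have dt0 := dpos t t0; have et0 := epos t t0; have gt0 := gpos t t0.
  have st0 := spos t t0; have wt0 := wpos t t0.
  have /andP[ut0 ut1] := u1P t t0.
  have hH : H <= b2 * eps t by rewrite mulrC -ler_pdivrMr.
  have [h1 h3 hN] : [/\ 10 * (b1 + 1) <= b2 * eps t, 10 * b3 <= b2 * eps t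
      & 15 + 10 * N%:R <= b2 * eps t].
    by move: hH; rewrite /H !ge_max => /andP[? /andP[]].
  have NR0 : 0 <= N%:R :> R by [].
  have h0 : 0 <= b2 * eps t by rewrite mulr_ge0 ?ltW.
  have K1 : 1 <= N%:R * b1 ^+ 2 + N%:R * b2 ^+ 2 * eps t ^+ 2 + delta t ^+ 2 + 1.
    have := mulr_ge0 NR0 (sqr_ge0 b1).
    have := mulr_ge0 (mulr_ge0 NR0 (sqr_ge0 b2)) (sqr_ge0 (eps t)).
    have := sqr_ge0 (delta t); lra.
  have g5 : gam t <= 1 / 5.
    have := step_le_of_u1_gt0 gt0 K1 ut0; lra.
  have [xb yb] := bounds t t0.
  have xb' : enorm (x t) <= z0 + c + cx by rewrite -/z0 in xb; lra.
  have [Oxt VIxt] := xtP t t0.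
  have U2ge0 : (b2 * eps t) ^+ 2 <= U2 t.
    rewrite /U2 /u2 exprMn.
    have := mulr_ge0 (sqr_ge0 (gam t)) (sqr_ge0 b3).
    have := mulr_ge0 (sqr_ge0 (gam t)) (mulr_ge0 (sqr_ge0 b2) (sqr_ge0 (eps t))).
    have := sqr_ge0 b3; nra.
  have diss := @lyap_dissipation R N a (fun i => partial i (f i))
    (fun i => partial i (penalty A b)) (delta t) (eps t) (gam t) (vsigma t)
    (w t) lmin b1 b2 b3 (U1 t) (U2 t) (x t) (xt t) (p t) (y t).
  have {}diss := diss N0 asym lminP.
  have PhiE v i : partial i (f i) v + delta t * v 0 i
      + eps t * partial i (penalty A b) v
      = Phi_de f A b (delta t) (eps t) v 0 i.
    by rewrite /Phi_de [RHS]mxE [X in _ = X + _]mxE /pseudo_gradient /grad !mxE.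
  have {}diss := diss _ _ _ (yii t t0) _ _ b2P dt0 et0 gt0 st0 wt0 b2_gt0
    _ h3 _ g5 ut0 _ U2ge0 _.
  apply: rslope_leW (lyap_slope t0 (rhott t) (fun s s0 => lip s t s0 t0)
    (drho t t0) (fun i => dx t i t0) (fun i j => dy t j i t0)
    (fun s i s0 => yii s s0 i)) _.
  apply: (@le_trans _ _ (2 * (- (1 / 4 * U1 t * vsigma t) * V t)
    + 2 * enorm (x t - xt t) * (cpx * R2 t))).
    rewrite lerD2r ler_pM2l//; apply: diss.
    - have := Phi_de_strongly_monotone A b (delta t) (x t) (xt t) F_monotone (ltW et0).
      rewrite -enorm_sqr innerE; congr (_ <= _); apply: eq_bigr => i _.
      rewrite /= !PhiE; move: (Phi_de _ _ _ _ _) => P; by rewrite !mxE.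
    - have := VIxt _ (Op t); rewrite innerE; congr (_ <= _); apply: eq_bigr => i _.
      by rewrite /= PhiE mulrC; move: (Phi_de _ _ _ _ _) => P; rewrite !mxE.
    - by move=> i; rewrite mxE; exact: proj_onto_variational.
    - by move=> i; exact: b1P.
    - move=> i; apply: b3P => //; have := yb i; rewrite -/z0; lra.
    - lra.
    - by apply: le_trans hN _; rewrite expr2 ler_peMl//; lra.
    - rewrite /U1 /u1 exprMn -subr_ge0.
      rewrite (_ : _ - _ = gam t ^+ 2 * (N%:R * b1 ^+ 2 + delta t ^+ 2 + 1)); last ring.
      rewrite mulr_ge0 ?sqr_ge0// !addr_ge0 ?sqr_ge0// mulr_ge0 ?sqr_ge0//.
    - apply: (@theta_lower _ N) (u1P t t0) (ltW st0) _ (thetaP t t0).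
      exact: le_trans (sqr_ge0 _) U2ge0.
  have R20 : 0 <= R2 t by rewrite /R2 /r2 divr_ge0 ?addr_ge0// ltW.
  (* The drift term is linear in the distance X to the target: 2 X <= 1 + X^2. *)
  have XV : 2 * enorm (x t - xt t) <= 1 + V t.
    have : enorm (x t - xt t) ^+ 2 <= V t.
      rewrite /V /lyap lerDl; apply: sumr_ge0 => i _.
      by apply: sumr_ge0 => j _; exact: sqr_ge0.
    by have := sqr_ge0 (enorm (x t - xt t) - 1); nra.
  have := ler_wpM2r (mulr_ge0 (ltW cpx0) R20) XV.
  by rewrite /u; lra.
have Vto0 : V t @[t --> +oo] --> 0.
  exact: (lyapunov_vanishing cV cu u_gt0 (fun t _ => V0 t) cpx0
    intu1 r2u1 slope).
have xtto := regularized_solutions_cvg cF F_monotone Om_convex Om_compact Q_slater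
  cxP xstarP dpos epos xtP d0 d2e eoo.
have diff0 : x t - xt t @[t --> +oo] --> (0 : 'rV[R]_N).
  apply/cvgrPdist_le => e e0.
  have e20 : 0 < e ^+ 2 by rewrite exprn_gt0.
  have Vsmall : \forall t \near +oo, V t <= e ^+ 2 by exact: (cvgr_le 0).
  apply: filterS Vsmall => t Vt.
  rewrite sub0r normrN; apply: le_trans (norm_le_enorm _) _.
  rewrite -(@ler_pXn2r _ 2)// ?nnegrE ?enorm_ge0 ?(ltW e0)//.
  apply: le_trans Vt; rewrite /V /lyap lerDl; apply: sumr_ge0 => i _.
  by apply: sumr_ge0 => j _; exact: sqr_ge0.
have -> : x = fun t => (x t - xt t) + xt t.
  by apply/funext => t; rewrite subrK.
by rewrite -[xstar]add0r; apply: cvgD.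
Unshelve. all: by end_near. Qed.
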